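(* There exists a universal constant $C>0$ such that the following holds. Let $n\ge1$, $0<\sigma_{\min}\le\sigma_{\max}<\infty$, $\mu\in\mathbb{R}$, and $\sigma_{\min}\le\sigma_i\le\sigma_{\max}$ for all $i\in[n]$. Let $X_1,\dots,X_n$ be independent with $X_i\sim\mathcal{N}(\mu,\sigma_i^2)$, let $G_n=\frac1n\sum_{i=1}^n\delta_{\sigma_i}$, and let $$(\widehat\mu,\widehat G)\in\operatorname*{arg\,max}_{\mu'\in\mathbb{R},\ \operatorname{supp}(G)\subseteq[\sigma_{\min},\sigma_{\max}]}\ \frac1n\sum_{i=1}^n\log f_{\mu',G}(X_i).$$ Then for every $\delta\in(0,1)$, with probability at least $1-\delta$, $$H^2(f_{\mu,G_n},f_{\widehat\mu,\widehat G})\le\frac Cn\left(\log^3\!\Big(\frac{n\sigma_{\max}}{\sigma_{\min}}\Big)\Big(\log\log\Big(\frac{n\sigma_{\max}}{\sigma_{\min}}\Big)\Big)^4+\log\frac1\delta\right).$$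
   Context: For $\mu\in\mathbb{R}$ and a probability distribution $G$ on $(0,\infty)$, $f_{\mu,G}(x)=\mathbb{E}_{\sigma\sim G}\big[\frac1\sigma\varphi\big(\frac{x-\mu}{\sigma}\big)\big]$, where $\varphi$ is the standard normal density. The squared Hellinger distance between densities is $H^2(p,q)=\int(\sqrt p-\sqrt q)^2\,dx$ (no factor $1/2$). In the maximization, $G$ ranges over all probability distributions supported on $[\sigma_{\min},\sigma_{\max}]$, and $(\widehat\mu,\widehat G)$ is any maximizer. Convention: the quantities $\log(n\sigma_{\max}/\sigma_{\min})$ and $\log\log(n\sigma_{\max}/\sigma_{\min})$ are read as $\max\{1,\cdot\}$ of themselves. *)

(* Defs.v *)
From HB Require Import structures.
From mathcomp Require Import all_boot all_order all_algebra.
From mathcomp Require Import all_classical all_reals all_analysis.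

Set Implicit Arguments.
Unset Strict Implicit.
Unset Printing Implicit Defensive.

Import Order.TTheory GRing.Theory Num.Theory.
Import numFieldNormedType.Exports.

Local Open Scope classical_set_scope.
Local Open Scope ring_scope.

Section mutual_independence.
Context d (T : measurableType d) (R : realType) (P : probability T R).

Definition mutually_independent (n : nat) (X : 'I_n -> {RV P >-> R}) : Prop :=
  forall (J : {set 'I_n}) (A : 'I_n -> set (measurableTypeR R)),
    (forall i, measurable (A i)) ->
    P (\bigcap_(i in [set j | j \in J]) X i @^-1` A i) =
    (\prod_(i in J) P (X i @^-1` A i))%E.

End mutual_independence.

Section empirical_measure.
Local Open Scope ereal_scope.
Context (R : realType) (n : nat) (s : 'I_n -> R).

Definition empirical (A : set (measurableTypeR R)) : \bar R :=
  (n%:R^-1)%:E * \sum_(i < n) \d_(s i) A.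

Let empirical0 : empirical set0 = 0.
Proof. by rewrite /empirical big1 ?mule0// => i _; rewrite measure0. Qed.

Let empirical_ge0 A : 0 <= empirical A.
Proof. by rewrite mule_ge0// ?lee_fin ?invr_ge0// sume_ge0. Qed.

Let empirical_sigma_additive : semi_sigma_additive empirical.
Proof.
move=> F mF tF mUF; rewrite /empirical.
rewrite [X in X @ \oo --> _](_ : _ = (fun k =>
    (n%:R^-1)%:E * \sum_(0 <= j < k) \sum_(i < n) \d_(s i) (F j))); last first.
  by apply/funext => k; rewrite ge0_sume_distrr// => j _; exact: sume_ge0.
apply: cvgeZl => //; rewrite [X in _ --> X](_ : _ =
    lim ((fun k => \sum_(0 <= j < k) \sum_(i < n) \d_(s i) (F j)) @ \oo)).
  by apply: is_cvg_ereal_nneg_natsum => k _; exact: sume_ge0.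
rewrite nneseries_sum//; apply: eq_bigr => /= i _.
exact: measure_semi_bigcup.
Qed.

HB.instance Definition _ := isMeasure.Build _ _ _ empirical
  empirical0 empirical_ge0 empirical_sigma_additive.

Lemma empirical_setT : (0 < n)%N -> empirical setT = 1.
Proof.
move=> n0; rewrite /empirical; under eq_bigr do rewrite diracT.
by rewrite sumEFin -EFinM sumr_const card_ord mulVf// pnatr_eq0 -lt0n.
Qed.

End empirical_measure.

Section scale_mixture.
Context (R : realType).

(* [mixture_pdf m G x] is E_{s ~ G}[s^-1 * phi ((x - m) / s)], for a law [G]
   carried by (0, +oo). *)
Definition mixture_pdf (m : R)
    (G : {measure set (measurableTypeR R) -> \bar R}) (x : R) : R :=
  \int[G]_(s in `]0, +oo[) (s^-1 * normal_pdf 0 1 ((x - m) / s)).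

(* Squared Hellinger distance, without the factor 1/2. *)
Definition hellinger2 (p q : R -> R) : \bar R :=
  (\int[lebesgue_measure]_x (((Num.sqrt (p x) - Num.sqrt (q x)) ^+ 2)%:E))%E.

(* The topological support. *)
Definition supp (G : probability (measurableTypeR R) R) : set R :=
  [set x | forall U : set R, open U -> U x -> (0 < G U)%E].

Definition mean_loglik (n : nat) (x : 'I_n -> R) (m : R)
    (G : probability (measurableTypeR R) R) : R :=
  n%:R^-1 * \sum_(i < n) ln (mixture_pdf m G (x i)).

Definition is_mle (a b : R) (n : nat) (x : 'I_n -> R) (m : R)
    (G : probability (measurableTypeR R) R) : Prop :=
  supp G `<=` `[a, b] /\
  forall (m' : R) (G' : probability (measurableTypeR R) R),
    supp G' `<=` `[a, b] -> mean_loglik x m' G' <= mean_loglik x m G.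

Definition log1 (t : R) : R := Num.max 1 (ln t).

(* For [t >= 1], which is the case below, both readings of the inner logarithm,
   [ln t] and [log1 t], give the same value, since [ln] is 0 at 0. *)
Definition loglog1 (t : R) : R := Num.max 1 (ln (ln t)).

End scale_mixture.

(* Main.v *)
Require Import Defs.
From HB Require Import structures.
From mathcomp Require Import all_boot all_order all_algebra.
From mathcomp Require Import all_classical all_reals all_analysis.
From mathcomp Require Import measurable_realfun.
From mathcomp Require Import ring lra.

Set Implicit Arguments.
Unset Strict Implicit.
Unset Printing Implicit Defensive.

Import Order.TTheory GRing.Theory Num.Theory.
Import numFieldNormedType.Exports.

Local Open Scope classical_set_scope.
Local Open Scope ring_scope.

(** Let [fbar] be the average of the densities [p_i] of the observations; it is
    the true mixture.  For a fixed [q >= 0], independence followed by the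
    inequality of arithmetic and geometric means gives
      E prod_i sqrt (q (X_i) / fbar (X_i)) = prod_i int sqrt (q / fbar) p_i
                                          <= (int sqrt (q fbar)) ^ n,
    so that a sample which is not identically distributed behaves as if it were
    drawn from [fbar] ([integral_prod_sqrt_ratio]).  By Markov's inequality and
    a union bound, for [N] functions [q] at once, the product stays below
    (int sqrt (q fbar) + 1/n) ^ n * N / delta outside an event of probability
    [delta] ([exists_likelihood_event]).  If the fitted density [f] lies below
    such a [q], the product is at least 1, because [f] is at least as likely as
    [fbar]; hence
      n (1 - int sqrt (q fbar)) <= ln (N / delta) + O(1).
    When the affinity int sqrt (q fbar) exceeds int sqrt (f fbar) by O(1/n) only,
    the left-hand side is n H^2 / 2 up to O(1), since
    H^2 = 2 - 2 int sqrt (f fbar).  This is [hellinger_mle_covering].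

    It remains to cover all mixtures by N envelopes with
    ln N = O(ln ^ 3 (n smax / smin)).  An envelope is a mixture plus
    [net_tolerance * weight]: the tolerance is polynomially small, and the weight
    grows like a Gaussian factor that sqrt fbar still absorbs
    ([affinity_envelope]).  This growth puts all the mixtures with a remote
    center in a single cell, because such a mixture is tiny near mu
    ([gauss_scale_far]).  The other centers are rounded to a grid, and the
    interval of scales is cut into O(ln (n smax / smin)) dyadic pieces.  On the
    piece that starts at alpha, the kernel at distance y from the center is a
    constant multiple of the following function of t = alpha / s, with
    z = y^2 / (2 alpha^2):
      t exp (- z t^2) / alpha.
    Either z is large and the kernel is negligible ([scale_far]), or z is of
    logarithmic size, a Taylor polynomial with logarithmically many terms is
    accurate, and the contribution of the piece depends, up to a small error,
    only on that many moments of t ([scale_near]).  Rounding these moments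
    assigns to every mixture a code; two mixtures with the same code are close
    ([net_code_close]), and a code consists of O(ln ^ 2) numbers, each with
    polynomially many values ([card_net_index]). *)

(** * Expectations of products of independent variables *)
Section weighted_transfer.
Import HBNNSimple.
Context dY (Y : measurableType dY) (R : realType).

Lemma integral_weighted_nnsfun d (T : measurableType d)
  (m : {measure set T -> \bar R}) (X : T -> Y) (W : T -> R)
  (mX : measurable_fun setT X) (mW : measurable_fun setT W)
  (W0 : forall t, 0 <= W t) (h : {nnsfun Y >-> R}) :
  (\int[m]_t (W t * h (X t))%:E =
   \sum_(k \in range h) k%:E * \int[m]_t (W t * \1_(h @^-1` [set k]) (X t))%:E)%E.
Proof.
have mI k : measurable_fun setT (fun t => W t * \1_(h @^-1` [set k]) (X t)).
  apply: measurable_funM => //; apply: measurableT_comp => //.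
transitivity (\int[m]_t (\sum_(k \in range h)
    (k * (W t * \1_(h @^-1` [set k]) (X t)))%:E))%E.
  apply: eq_integral => t _; rewrite fimfunE fsumEFin//; congr EFin.
  rewrite !fsbig_finite//= big_distrr/=.
  by apply: eq_bigr => i _; rewrite mulrCA.
rewrite ge0_integral_fsum//; first last.
- move=> k t _; rewrite lee_fin; have [kh|kh] := eqVneq k (h (X t)).
    by rewrite mulr_ge0 ?mulr_ge0// kh.
  by rewrite indicE memNset ?mulr0//= => /esym/eqP; apply/negP.
- by move=> k; apply/measurable_EFinP; apply: measurable_funM.
apply: eq_fsbigr => k /set_mem [y _ yk].
have k0 : 0 <= k by rewrite -yk.
under eq_integral do rewrite EFinM.
rewrite ge0_integralZl//.
- exact/measurable_EFinP.
- by move=> t _; rewrite lee_fin mulr_ge0.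
Qed.

Lemma integral_weighted_lim d (T : measurableType d)
  (m : {measure set T -> \bar R}) (X : T -> Y) (W : T -> R)
  (mX : measurable_fun setT X) (mW : measurable_fun setT W)
  (W0 : forall t, 0 <= W t) (g : Y -> R)
  (mg : measurable_fun setT (EFin \o g)) (g0 : forall y, 0 <= g y) :
  (\int[m]_t (W t * g (X t))%:E =
   limn (fun n => \int[m]_t (W t * nnsfun_approx measurableT mg n (X t))%:E))%E.
Proof.
set h := nnsfun_approx measurableT mg.
rewrite -monotone_convergence//.
- apply: eq_integral => t _; apply/esym/cvg_lim => //.
  have := @cvg_nnsfun_approx _ _ _ _ measurableT _ mg (fun y _ => g0 y) (X t) I.
  move=> /(@cvgeZl _ _ _ _ _ (W t)%:E isT).
  by rewrite -EFinM.
- move=> n; apply/measurable_EFinP; apply: measurable_funM => //.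
  by apply: measurableT_comp.
- by move=> n t _; rewrite lee_fin mulr_ge0.
- move=> t _ i j ij; rewrite lee_fin ler_wpM2l//.
  exact/lefP/nd_nnsfun_approx.
Qed.

(** A weighted measure pushed forward by a map is determined by its values on
    measurable sets.  Comparing two of them covers both uses below: an
    expectation as an integral against a density, and the separation of one
    factor from a product of independent variables. *)
Lemma integral_weighted_transfer d1 (T1 : measurableType d1)
  d2 (T2 : measurableType d2)
  (m1 : {measure set T1 -> \bar R}) (m2 : {measure set T2 -> \bar R})
  (X1 : T1 -> Y) (X2 : T2 -> Y) (W1 : T1 -> R) (W2 : T2 -> R) (g : Y -> R) :
  measurable_fun setT X1 -> measurable_fun setT X2 ->
  measurable_fun setT W1 -> measurable_fun setT W2 ->
  (forall t, 0 <= W1 t) -> (forall t, 0 <= W2 t) ->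
  (forall A, measurable A -> \int[m1]_t (W1 t * \1_A (X1 t))%:E =
     \int[m2]_t (W2 t * \1_A (X2 t))%:E)%E ->
  measurable_fun setT g -> (forall y, 0 <= g y) ->
  (\int[m1]_t (W1 t * g (X1 t))%:E = \int[m2]_t (W2 t * g (X2 t))%:E)%E.
Proof.
move=> mX1 mX2 mW1 mW2 W10 W20 H mg0 g0.
have mg : measurable_fun setT (EFin \o g) by exact/measurable_EFinP.
rewrite !(integral_weighted_lim _ _ _ _ mg)//.
congr (limn _); apply/funext => n.
rewrite !integral_weighted_nnsfun//.
by apply: eq_fsbigr => k _; rewrite H.
Qed.

End weighted_transfer.

Section independence.
Context d (T : measurableType d) (R : realType) (P : probability T R).
Context (n : nat) (X : 'I_n -> {RV P >-> R}).

Local Notation pr j A := (fine (P (X j @^-1` A))).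

Lemma measurable_RV_preimage (i : 'I_n) (A : set (measurableTypeR R)) :
  measurable A -> measurable (X i @^-1` A).
Proof. by move=> mA; rewrite -[X in measurable X]setTI; exact: measurable_funP. Qed.

Lemma measurable_bigcap_RV_preimage (J : {set 'I_n})
    (A : 'I_n -> set (measurableTypeR R)) : (forall i, measurable (A i)) ->
  measurable (\bigcap_(i in [set j | j \in J]) X i @^-1` A i).
Proof.
move=> mA; apply: fin_bigcap_measurable => //.
by move=> i _; exact: measurable_RV_preimage.
Qed.

(** Independence speaks of events, so the events are replaced by functions one
    coordinate at a time.  The induction carries the indicator of an event on
    other coordinates; multiplied by the factors already treated, it is the
    weight to which [integral_weighted_transfer] applies. *)
Lemma integral_prod_indic (g : 'I_n -> R -> R) (e : 'I_n -> R) :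
  mutually_independent X ->
  (forall i, measurable_fun setT (g i)) -> (forall i x, 0 <= g i x) ->
  (forall i, \int[P]_w (g i (X i w))%:E = (e i)%:E)%E ->
  forall r : seq 'I_n, uniq r -> forall (J : {set 'I_n})
    (A : 'I_n -> set (measurableTypeR R)), (forall i, measurable (A i)) ->
    (forall i, i \in r -> i \notin J) ->
  (\int[P]_w ((\prod_(i <- r) g i (X i w)) *
      \1_(\bigcap_(i in [set j | j \in J]) X i @^-1` A i) w)%:E =
   ((\prod_(i <- r) e i) * \prod_(j in J) pr j (A j))%:E)%E.
Proof.
move=> indX mg g0 ge; elim=> [|i r IHr] /=.
  move=> _ J A mA _; under eq_integral do rewrite big_nil mul1r.
  rewrite integral_indic//; last exact: measurable_bigcap_RV_preimage.
  rewrite setIT; apply: (etrans (indX J A mA)).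
  rewrite big_nil mul1r -prodEFin; apply: eq_bigr => j _.
  by rewrite fineK// fin_num_measure//; exact: measurable_RV_preimage.
move=> /andP[ir ur] J A mA dJ.
pose W1 w := (\prod_(i <- r) g i (X i w)) *
      \1_(\bigcap_(i in [set j | j \in J]) X i @^-1` A i) w.
pose c := (\prod_(i <- r) e i) * \prod_(j in J) pr j (A j).
have iJ : i \notin J by apply: dJ; rewrite mem_head.
have e0 j : 0 <= e j.
  by rewrite -lee_fin -ge integral_ge0// => w _; rewrite lee_fin.
have c0 : 0 <= c by apply: mulr_ge0; apply: prodr_ge0 => // j _; rewrite fine_ge0.
have mW1 : measurable_fun setT W1.
  apply: measurable_funM.
    by apply: measurable_prod => j _; exact: measurableT_comp.
  exact/measurable_indic/measurable_bigcap_RV_preimage.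
have W10 t : 0 <= W1 t by apply: mulr_ge0 => //; exact: prodr_ge0.
have key B : measurable B -> (\int[P]_t (W1 t * \1_B (X i t))%:E =
     \int[P]_t (c * \1_B (X i t))%:E)%E.
  move=> mB.
  have mB' : measurable (X i @^-1` B) by exact: measurable_RV_preimage.
  (* adding the coordinate i, with the event B, to those in J *)
pose A' j := if j == i then B else A j.
  have mA' j : measurable (A' j) by rewrite /A'; case: ifP => _; [exact: mB|exact: mA].
  transitivity (\int[P]_w ((\prod_(i <- r) g i (X i w)) *
      \1_(\bigcap_(j in [set j | j \in i |: J]) X j @^-1` A' j) w)%:E)%E.
    apply: eq_integral => w _; rewrite /W1 -mulrA; congr (_ * _)%:E.
    rewrite !indicE.
    have -> : (X i w \in B) = (w \in X i @^-1` B).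
      by apply/idP/idP => /set_mem h; apply/mem_set.
    rewrite -natrM mulnb -in_setI; congr (_ (_ \in _))%:R.
    rewrite eqEsubset; split => [x [xJ xB] j|x xJ].
      rewrite /= !inE /A' => /orP[/eqP ->|jJ]; first by rewrite eqxx.
      case: eqP => [->//|_]; exact: xJ.
    split=> [j /= jJ|].
      have := xJ j; rewrite /= !inE jJ orbT /A'; case: eqP => [ji|_ /(_ isT)//].
      by rewrite -ji jJ in iJ.
    by have := xJ i; rewrite /= !inE eqxx /A' eqxx => /(_ isT).
  rewrite IHr//; last first.
    move=> j jr; rewrite !inE negb_or; apply/andP; split.
      by apply: contraNneq ir => <-.
    by apply: dJ; rewrite inE jr orbT.
  have -> : \prod_(j in i |: J) pr j (A' j) =
      fine (P (X i @^-1` B)) * \prod_(j in J) pr j (A j).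
    rewrite big_setU1//= /A' eqxx; congr (_ * _); apply: eq_bigr => j jJ.
    by have /negbTE -> : j != i by apply: contraNneq iJ => <-.
  transitivity (\int[P]_t (c%:E * (\1_(X i @^-1` B) t)%:E))%E; last first.
    apply: eq_integral => t _; rewrite -EFinM; congr (_ * _)%:E.
  rewrite ge0_integralZl ?lee_fin//; last exact/measurable_EFinP.
  rewrite integral_indic// setIT.
  rewrite -[X in (_ * X)%E]fineK ?fin_num_measure// -EFinM.
  by congr EFin; rewrite /c; ring.
have H : (\int[P]_w (W1 w * g i (X i w))%:E =
          \int[P]_w (c * g i (X i w))%:E)%E.
  by apply: (integral_weighted_transfer (W2 := cst c) _ _ mW1 _ W10 _ key).
transitivity (\int[P]_w (W1 w * g i (X i w))%:E)%E.
  by apply: eq_integral => w _; rewrite /W1 big_cons; congr EFin; ring.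
rewrite H.
under eq_integral do rewrite EFinM.
rewrite ge0_integralZl ?lee_fin//; last 2 first.
- by apply/measurable_EFinP; exact: measurableT_comp.
- by move=> w _; rewrite lee_fin.
by rewrite ge big_cons -EFinM /c; congr EFin; ring.
Qed.

Lemma integral_prod_indep (g : 'I_n -> R -> R) (e : 'I_n -> R) :
  mutually_independent X ->
  (forall i, measurable_fun setT (g i)) -> (forall i x, 0 <= g i x) ->
  (forall i, \int[P]_w (g i (X i w))%:E = (e i)%:E)%E ->
  (\int[P]_w (\prod_(i < n) g i (X i w))%:E = (\prod_(i < n) e i)%:E)%E.
Proof.
move=> indX mg g0 ge.
have := integral_prod_indic indX mg g0 ge (index_enum_uniq 'I_n)
  (J := finset.set0) (A := fun=> setT) (fun=> measurableT).
rewrite big_set0 mulr1 => <-; last by move=> i; rewrite inE.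
apply: eq_integral => w _; rewrite indicE mem_set ?mulr1//.
Qed.

End independence.


(** * Likelihood ratios against the average density *)
Section likelihood_ratio.
Context d (T : measurableType d) (R : realType) (P : probability T R).
Context (n : nat) (X : 'I_n -> {RV P >-> R}) (p : 'I_n -> R -> R).
Notation mu := (@lebesgue_measure R).

Hypothesis n_gt0 : (0 < n)%N.
Hypothesis indX : mutually_independent X.
Hypothesis mp : forall i, measurable_fun setT (p i).
Hypothesis p_ge0 : forall i x, 0 <= p i x.
Hypothesis law : forall i (A : set (measurableTypeR R)), measurable A ->
  P (X i @^-1` A) = (\int[mu]_(x in A) (p i x)%:E)%E.

Definition average_density x := n%:R^-1 * \sum_(i < n) p i x.

Hypothesis average_gt0 : forall x, 0 < average_density x.

Lemma measurable_sqrtr_comp d' (T' : measurableType d') (f : T' -> R) :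
  measurable_fun setT f -> measurable_fun setT (fun x => Num.sqrt (f x)).
Proof.
move=> mf; apply: measurableT_comp => //.
apply: continuous_measurable_fun; exact: sqrt_continuous.
Qed.

(** Inversion is not continuous at 0, whereas exp o (- ln) is measurable on the
    whole line and agrees with it on positive numbers. *)
Lemma measurable_invr_comp d' (T' : measurableType d') (f : T' -> R) :
  measurable_fun setT f -> (forall x, 0 < f x) ->
  measurable_fun setT (fun x => (f x)^-1).
Proof.
move=> mf f0; rewrite (_ : (fun _ => _) = (fun x => expR (- ln (f x)))).
  apply: measurableT_comp => //; apply: measurable_funN.
  by apply: measurableT_comp => //; exact: measurable_ln.
by apply/funext => x; rewrite expRN lnK// posrE.
Qed.

Lemma measurable_average : measurable_fun setT average_density.
Proof. by apply: measurable_funM => //; exact: measurable_sum. Qed.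

Lemma integral_law i (g : R -> R) :
  measurable_fun setT g -> (forall x, 0 <= g x) ->
  (\int[P]_w (g (X i w))%:E = \int[mu]_x (p i x * g x)%:E)%E.
Proof.
move=> mg g0.
transitivity (\int[P]_w (cst 1 w * g (X i w))%:E)%E.
  by apply: eq_integral => w _; rewrite mul1r.
apply: (integral_weighted_transfer (Y := R) (m1 := P) (m2 := mu) (X2 := id)) => //.
  exact: mp.
move=> A mA.
transitivity (\int[P]_t (\1_(X i @^-1` A) t)%:E)%E.
  by apply: eq_integral => t _; rewrite mul1r.
rewrite integral_indic ?setIT//; last exact: measurable_RV_preimage.
apply: (etrans (law _ mA)); rewrite [LHS]integral_mkcond; apply: eq_integral => x _.
by rewrite patchE indicE; case: ifPn; rewrite ?mulr1 ?mulr0.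
Qed.

Definition sqrt_ratio (q : R -> R) x := Num.sqrt (q x / average_density x).

Lemma measurable_sqrt_ratio q :
  measurable_fun setT q -> measurable_fun setT (sqrt_ratio q).
Proof.
move=> mq; apply: measurable_sqrtr_comp; apply: measurable_funM => //.
exact: measurable_invr_comp measurable_average average_gt0.
Qed.

(** The observations have different laws: by the inequality of arithmetic and
    geometric means, the product of the integrals of sqrt (q / fbar) against the
    [p_i] is at most the n-th power of their mean, and this mean is the affinity
    of [q] with the average density. *)
Lemma integral_prod_sqrt_ratio (q : R -> R) (a : R) :
  measurable_fun setT q -> (forall x, 0 <= q x) ->
  (\int[mu]_x (Num.sqrt (q x * average_density x))%:E = a%:E)%E ->
  (\int[P]_w (\prod_(i < n) sqrt_ratio q (X i w))%:E <= (a ^+ n)%:E)%E.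
Proof.
move=> mq q0 qa; pose g := sqrt_ratio q.
have mg : measurable_fun setT g by exact: measurable_sqrt_ratio.
have g0 x : 0 <= g x by exact: sqrtr_ge0.
have n0 : (n%:R : R) != 0 by rewrite pnatr_eq0 -lt0n.
have sqE x : Num.sqrt (q x * average_density x) = average_density x * g x.
  have f0 := average_gt0 x.
  rewrite /g /sqrt_ratio -{2}(ger0_norm (ltW f0)) -sqrtr_sqr -sqrtrM ?sqr_ge0//.
  by congr Num.sqrt; rewrite expr2 mulrACA divff ?gt_eqF// mulr1 mulrC.
have suma : (\sum_(i < n) \int[mu]_x (p i x * g x)%:E = (n%:R * a)%:E)%E.
  rewrite -ge0_integral_sum//; last 2 first.
  - by move=> i; apply/measurable_EFinP; apply: measurable_funM; [exact: mp|exact: mg].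
  - by move=> i x _; rewrite lee_fin mulr_ge0.
  rewrite EFinM -qa -ge0_integralZl//; last first.
    apply/measurable_EFinP; apply: measurable_sqrtr_comp.
    apply: measurable_funM; [exact: mq|exact: measurable_average].
  apply: eq_integral => x _; rewrite sumEFin sqE -EFinM; congr EFin.
  by rewrite /average_density -mulr_suml mulrA mulrA divff// mul1r.
have ipg0 i : (0 <= \int[mu]_x (p i x * g x)%:E)%E.
  by apply: integral_ge0 => x _; rewrite lee_fin mulr_ge0.
have fing i : (\int[mu]_x (p i x * g x)%:E)%E \is a fin_num.
  rewrite ge0_fin_numE//; apply: (@le_lt_trans _ _ (n%:R * a)%:E); last exact: ltry.
  by rewrite -suma (bigD1 i)//= leeDl// sume_ge0.
pose e i := fine (\int[mu]_x (p i x * g x)%:E)%E.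
have ge i : (\int[P]_w (g (X i w))%:E = (e i)%:E)%E.
  by rewrite integral_law// /e fineK.
rewrite (integral_prod_indep (g := fun=> g) indX _ _ ge)//.
rewrite lee_fin.
have := @leif_AGM R 'I_n predT e (fun i _ => fine_ge0 (ipg0 i)).
rewrite card_ord => -[+ _] => /le_trans -> //.
have -> : \sum_(i < n) e i = n%:R * a.
  apply: EFin_inj; rewrite -suma -sumEFin; apply: eq_bigr => i _.
  by rewrite /e fineK.
by rewrite mulrC mulrA mulVf// mul1r.
Qed.

Lemma prob_prod_sqrt_ratio (q : R -> R) (a M : R) :
  measurable_fun setT q -> (forall x, 0 <= q x) ->
  (\int[mu]_x (Num.sqrt (q x * average_density x))%:E = a%:E)%E -> 0 < M ->
  (P [set w | (M <= \prod_(i < n) sqrt_ratio q (X i w))%R] <= (a ^+ n / M)%:E)%E.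
Proof.
move=> mq q0 qa M0.
have mZ : measurable_fun setT (fun w => \prod_(i < n) sqrt_ratio q (X i w)).
  by apply: measurable_prod => i _; apply: measurableT_comp => //; exact: measurable_sqrt_ratio.
have Z0 w : 0 <= \prod_(i < n) sqrt_ratio q (X i w).
  by apply: prodr_ge0 => i _; exact: sqrtr_ge0.
have := @le_integral_comp_abse _ T R P setT measurableT
  (fun w => (\prod_(i < n) sqrt_ratio q (X i w))%:E) M id.
rewrite setTI => H.
rewrite -(@lee_pmul2l _ M%:E)// -EFinM mulrC divfK ?gt_eqF//.
apply: le_trans; last exact: integral_prod_sqrt_ratio mq q0 qa.
rewrite [X in (_ * P X)%E](_ : _ =
    [set w | (M%:E <= `|(\prod_(i < n) sqrt_ratio q (X i w))%:E|)%E]).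
  apply: (le_trans (H _ _ _ _ _)) => //.
    exact/measurable_EFinP.
  rewrite le_eqVlt; apply/orP; left; apply/eqP/eq_integral => w _.
  by rewrite gee0_abs ?lee_fin.
by apply/seteqP; split => w /=; rewrite lee_fin ger0_norm.
Qed.

Lemma prob_bigsetU_le (K : Type) (r : seq K) (A : K -> set T) (c : R) :
  (forall k, measurable (A k)) -> (forall k, P (A k) <= c%:E)%E ->
  (P (\big[setU/set0]_(k <- r) A k) <= ((size r)%:R * c)%:E)%E.
Proof.
move=> mA Ac; elim: r => [|k r IHr]; first by rewrite big_nil measure0 mul0r.
rewrite big_cons; apply: (le_trans (measureU2 _ _ _)) => //.
  exact: bigsetU_measurable.
by rewrite /= -natr1 mulrDl mul1r addrC EFinD leeD// Ac.
Qed.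

(** Markov's inequality for each of the finitely many [q], then a union bound.
    The majorants [b] keep the thresholds positive when an affinity vanishes. *)
Lemma exists_likelihood_event (K : finType) (q : K -> R -> R) (a b : K -> R)
    (delta : R) :
  (forall k, measurable_fun setT (q k)) -> (forall k x, 0 <= q k x) ->
  (forall k, \int[mu]_x (Num.sqrt (q k x * average_density x))%:E
     = (a k)%:E)%E ->
  (forall k, a k <= b k) -> (forall k, 0 < b k) -> 0 < delta ->
  exists E : set T, [/\ measurable E, ((1 - delta)%:E <= P E)%E &
    forall w, E w -> forall k, \prod_(i < n) sqrt_ratio (q k) (X i w) <
      b k ^+ n * (#|K|%:R / delta)].
Proof.
move=> mq q0 qa ab b0 d0.
have [K0|K_gt0] := posnP #|K|.
  exists setT; split => //; first by rewrite probability_setT lee_fin gerBl ltW.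
  by move=> w _ k; have := fintype0 k K0.
pose M k := b k ^+ n * (#|K|%:R / delta).
have M0 k : 0 < M k.
  by rewrite /M mulr_gt0 ?exprn_gt0// divr_gt0// ltr0n.
pose A k := [set w | M k <= \prod_(i < n) sqrt_ratio (q k) (X i w)].
have mA k : measurable (A k).
  rewrite -[A k]setTI; apply: measurable_fun_le => //.
  by apply: measurable_prod => i _; apply: measurableT_comp => //; exact: measurable_sqrt_ratio.
have a0 k : 0 <= a k.
  by rewrite -lee_fin -qa integral_ge0// => x _; rewrite lee_fin sqrtr_ge0.
have PA k : (P (A k) <= (delta / #|K|%:R)%:E)%E.
  apply: (le_trans (prob_prod_sqrt_ratio (mq k) (q0 k) (qa k) (M0 k))).
  rewrite lee_fin ler_pdivrMr// /M mulrCA.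
  have -> : delta / #|K|%:R * (#|K|%:R / delta) = 1.
    by rewrite mulrA divfK ?pnatr_eq0 -?lt0n// divff// gt_eqF.
  by rewrite mulr1; apply: lerXn2r; rewrite ?nnegrE// ltW.
exists (~` \big[setU/set0]_(k <- enum K) A k); split.
- by apply: measurableC; exact: bigsetU_measurable.
- rewrite probability_setC; last exact: bigsetU_measurable.
  rewrite EFinB leeB//; apply: (le_trans (prob_bigsetU_le (enum K) mA PA)).
  by rewrite -cardE lee_fin mulrCA divff ?mulr1// pnatr_eq0 -lt0n.
- move=> w Ew k; rewrite ltNge; apply/negP => Mk; apply: Ew.
  rewrite -bigcup_seq; exists k => //=; by rewrite mem_enum.
Qed.

(** If [f] is at least as likely as the average density, then the product of
    the sqrt (f / fbar) is at least 1, and so is the one of the larger [q].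
    Hence 1 < b ^ n * L, while b <= 1 - h <= exp (- h). *)
Lemma likelihood_event_deviation (q f : R -> R) (b h L : R) (x : 'I_n -> R) :
  (forall y, 0 < f y) -> (forall y, f y <= q y) -> 0 < b -> b <= 1 - h ->
  0 < L ->
  \prod_(i < n) sqrt_ratio q (x i) < b ^+ n * L ->
  \sum_(i < n) ln (average_density (x i)) <= \sum_(i < n) ln (f (x i)) ->
  n%:R * h <= ln L.
Proof.
move=> f0 fq b0 bh L0 ltL lelik.
have q0 y : 0 < q y by exact: lt_le_trans (f0 y) (fq y).
have r0 y : 0 < q y / average_density y by rewrite divr_gt0.
have s0 y : 0 < sqrt_ratio q y by rewrite sqrtr_gt0.
have sqrt_expR t : Num.sqrt (expR t) = expR (t / 2).
  by rewrite [in LHS](splitr t) expRD -expr2 sqrtr_sqr ger0_norm ?expR_ge0.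
have ge1 : 1 <= \prod_(i < n) sqrt_ratio q (x i).
  apply: (@le_trans _ _ (\prod_(i < n)
      expR ((ln (f (x i)) - ln (average_density (x i))) / 2))).
    rewrite -expR_sum -mulr_suml sumrB -expR0 ler_expR.
    by rewrite divr_ge0// subr_ge0.
  apply: Num.Theory.ler_prod => i _; rewrite expR_ge0/= -sqrt_expR ler_wsqrtr//.
  by rewrite expRD expRN !lnK ?posrE// ler_pM2r ?invr_gt0.
have bh' : b ^+ n <= (expR (n%:R * h))^-1.
  rewrite -expRN -mulrN expRM_natl; apply: lerXn2r; rewrite ?nnegrE ?expR_ge0 ?(ltW b0)//.
  by apply: le_trans bh _; exact: expR_ge1Dx.
rewrite -ler_expR lnK ?posrE//.
have := le_lt_trans ge1 ltL.
have := ler_wpM2r (ltW L0) bh' => /[swap] /lt_le_trans /[apply].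
by rewrite mulrC ltr_pdivlMr ?expR_gt0// mul1r => /ltW.
Qed.

End likelihood_ratio.


(** * Gaussian scale mixtures *)
Section support.
Context (R : realType) (G : probability (measurableTypeR R) R).

(** Every point outside the support has a null neighborhood; countably many
    intervals with rational end points suffice to cover the complement. *)
Lemma supp_compl_null (D : set R) : closed D -> supp G `<=` D -> G (~` D) = 0.
Proof.
move=> cD sD.
have mD : measurable (~` D) by apply: open_measurable; exact: closed_openC.
pose B (pq : rat * rat) : set R := `](ratr pq.1 : R), (ratr pq.2 : R)[%classic.
pose N (pq : rat * rat) : set R := if G (B pq) == 0%E then B pq else set0.
have mB pq : measurable (B pq) by exact: measurable_itv.
have mN pq : measurable (N pq).
  by rewrite /N; case: ifP => // _; exact: measurable0.
have GN pq : G (N pq) = 0 by rewrite /N; case: ifP => [/eqP//|_]; exact: measure0.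
pose F k := odflt set0 (omap N (unpickle k)).
have sub : ~` D `<=` \bigcup_k F k.
  move=> x Dx; have := contra_not (@sD x) Dx => /existsNP[U /not_implyP[oU]].
  move=> /not_implyP[Ux /negP]; rewrite -leNgt => GU.
  have /nbhs_ballP[e /= e0 eU] := open_nbhs_nbhs (conj oU Ux).
  have [|p] := @rat_in_itvoo R (x - e) x; first by rewrite ltrBlDr ltrDl.
  rewrite in_itv/= => /andP[p1 p2].
  have [|q] := @rat_in_itvoo R x (x + e); first by rewrite ltrDl.
  rewrite in_itv/= => /andP[q1 q2].
  have BU : B (p, q) `<=` U.
    move=> y; rewrite /B /= in_itv/= => /andP[y1 y2]; apply: eU.
    by rewrite /ball/= ltr_distlC; apply/andP; split; lra.
  (* keeps the code of the pair abstract *)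
  have [k Fk] : exists k, F k = N (p, q).
    by exists (pickle (p, q)); rewrite /F pickleK.
  exists k => //; rewrite Fk /N.
  have -> : G (B (p, q)) == 0%E.
    rewrite -measure_le0; apply: le_trans GU; apply: le_measure => //.
      by rewrite inE; exact: mB.
    by rewrite inE; exact: open_measurable.
  by rewrite /B/= in_itv/= p2 q1.
have FN : G.-negligible (\bigcup_k F k).
  apply: negligible_bigcup => k; apply/negligibleP.
    by rewrite /F; case: unpickle => //=; exact: measurable0.
  by rewrite /F; case: unpickle => [pq|]/=; [exact: GN|exact: measure0].
by apply/negligibleP => //; exact: negligibleS FN.
Qed.
End support.

Section normal_scale.
Context (R : realType).
Implicit Types (m s x y : R).

Definition gauss_scale s y : R := s^-1 * expR (- (y / s) ^+ 2 / 2).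

Lemma normal_peak_scale s : 0 < s -> normal_peak s = normal_peak 1 / s :> R.
Proof.
move=> s0; rewrite /normal_peak expr1n mul1r -mulrnAr sqrtrM ?sqr_ge0//.
by rewrite sqrtr_sqr gtr0_norm// invfM mulrC.
Qed.

Lemma normal_pdf_scale m s x : 0 < s ->
  normal_pdf m s x = normal_peak 1 * gauss_scale s (x - m).
Proof.
move=> s0; rewrite normal_pdfE ?gt_eqF// normal_peak_scale// /gauss_scale mulrA.
congr (_ * expR _); rewrite expr_div_n -[s ^+ 2 *+ 2]mulr_natr; field.
by rewrite gt_eqF.
Qed.

Lemma normal_pdf01 y : normal_pdf 0 1 y = normal_peak 1 * expR (- y ^+ 2 / 2) :> R.
Proof.
by rewrite normal_pdf_scale// /gauss_scale subr0 invr1 mul1r mulr1.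
Qed.

Lemma normal_peak1_gt0 : 0 < normal_peak 1 :> R.
Proof. exact: normal_peak_gt0 (oner_neq0 R). Qed.

Lemma normal_peak1_le1 : normal_peak 1 <= 1 :> R.
Proof.
have p1 : (1 : R) <= pi *+ 2 by rewrite -mulr_natr; have := pi_ge2 R; lra.
have p2 : (1 : R) <= Num.sqrt (pi *+ 2) by rewrite -{1}sqrtr1 ler_wsqrtr.
by rewrite /normal_peak expr1n mul1r invf_le1// (lt_le_trans ltr01).
Qed.

Lemma gauss_scale_ge0 s y : 0 < s -> 0 <= gauss_scale s y.
Proof. by move=> s0; rewrite mulr_ge0 ?expR_ge0// invr_ge0 ltW. Qed.

(** Writing the scale as exp (ln s) extends the kernel to a jointly measurable
    function on the whole plane without changing it for s > 0, which gives
    Tonelli's theorem a product space instead of a restricted domain. *)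
Lemma measurable_normal_pdf0_joint : measurable_fun setT
  (fun z : measurableTypeR R * measurableTypeR R =>
     normal_pdf 0 (expR (ln z.1)) z.2).
Proof.
have mln : measurable_fun setT
    (fun z : measurableTypeR R * measurableTypeR R => ln z.1 : R).
  by apply: measurableT_comp; [exact: measurable_ln|exact: measurable_fst].
rewrite (_ : (fun _ => _) = (fun z : measurableTypeR R * measurableTypeR R =>
  normal_peak 1 * (expR (- ln z.1) * expR (- (z.2 * expR (- ln z.1)) ^+ 2 / 2)))).
  apply: measurable_funM => //; apply: measurable_funM.
    by apply: measurableT_comp => //; apply: measurable_funN.
  apply: measurableT_comp => //; apply: measurable_funM => //.
  apply: measurable_funN; apply: measurable_funX; apply: measurable_funM.
    exact: measurable_snd.
  by apply: measurableT_comp => //; apply: measurable_funN.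
apply/funext => z; rewrite normal_pdf_scale ?expR_gt0// /gauss_scale subr0.
by rewrite expRN.
Qed.

End normal_scale.

Section bounded_integral.
Context (R : realType) (G : probability (measurableTypeR R) R).

Lemma le_prob_real (A : set (measurableTypeR R)) : measurable A -> fine (G A) <= 1.
Proof.
by move=> mA; rewrite -lee_fin fineK ?fin_num_measure//; exact: probability_le1.
Qed.

Lemma bounded_integrable (D : set (measurableTypeR R)) (g : R -> R) M :
  measurable D -> measurable_fun D g -> (forall s, D s -> `|g s| <= M) ->
  G.-integrable D (EFin \o g).
Proof.
move=> mD mg gM; apply: (le_integrable mD _ _ (finite_measure_integrable_cst G M mD)).
  exact/measurable_EFinP.
move=> s /gM h /=; rewrite lee_fin; apply: le_trans h _; exact: ler_norm.
Qed.

Lemma abs_Rintegral_le (D : set (measurableTypeR R)) (g : R -> R) M :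
  measurable D -> 0 <= M -> measurable_fun D g ->
  (forall s, D s -> `|g s| <= M) -> `| \int[G]_(s in D) g s | <= M.
Proof.
move=> mD M0 mg gM.
have ig := bounded_integrable mD mg gM.
apply: (le_trans (le_normr_Rintegral _ _)) => //.
apply: (@le_trans _ _ (\int[G]_(s in D) M)).
  apply: le_Rintegral => //.
  - exact: integrable_norm.
  - exact: finite_measure_integrable_cst.
by rewrite Rintegral_cst//; rewrite ler_piMr// le_prob_real.
Qed.

End bounded_integral.

Section mixture.
Context (R : realType) (a b : R) (G : probability (measurableTypeR R) R).
Hypothesis a_gt0 : 0 < a.
Hypothesis Gab : G (~` `[a, b]) = 0.
Notation ab := (`[a, b]%classic : set (measurableTypeR R)).

Lemma measurable_ab : measurable ab. Proof. exact: measurable_itv. Qed.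
#[local] Hint Resolve measurable_ab : core.

Lemma ab_gt0 s : ab s -> 0 < s.
Proof. by rewrite /= in_itv/= => /andP[+ _]; exact: lt_le_trans. Qed.

Lemma prob_ab : G ab = 1%E.
Proof.
have := probability_setC G measurable_ab; rewrite Gab.
move=> /esym/eqP; rewrite sube_eq ?add0e ?fin_num_measure//; first by move=> /eqP <-.
Qed.

Lemma measurable_gauss_scale_on (D : set (measurableTypeR R)) y :
  D `<=` [set s | 0 < s] -> measurable_fun D (fun s : R => gauss_scale s y).
Proof.
move=> D0; apply: (eq_measurable_fun (fun s => expR (- ln s) *
    expR (- (y * expR (- ln s)) ^+ 2 / 2))).
  by move=> s /set_mem /D0 s0; rewrite /gauss_scale expRN lnK ?posrE.
apply: measurable_funTS; apply: measurable_funM.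
  apply: measurableT_comp => //; apply: measurable_funN; exact: measurable_ln.
apply: measurableT_comp => //; apply: measurable_funM => //.
apply: measurable_funN; apply: measurable_funX; apply: measurable_funM => //.
apply: measurableT_comp => //; apply: measurable_funN; exact: measurable_ln.
Qed.

Lemma gauss_scale_le s y : ab s -> `|gauss_scale s y| <= a^-1.
Proof.
move=> abs; have s0 := ab_gt0 abs; rewrite ger0_norm ?gauss_scale_ge0//.
have as_ : a <= s by move: abs; rewrite /= in_itv/= => /andP[].
rewrite /gauss_scale -[leRHS]mulr1; apply: ler_pM.
- by rewrite invr_ge0 ltW.
- exact: expR_ge0.
- by rewrite lef_pV2.
- by rewrite -expR0 ler_expR mulNr oppr_le0 divr_ge0// sqr_ge0.
Qed.

Lemma integrable_gauss_scale (D : set (measurableTypeR R)) y :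
  measurable D -> D `<=` ab ->
  G.-integrable D (fun s => (gauss_scale s y)%:E).
Proof.
move=> mD Dab; apply: (@bounded_integrable _ _ _ (fun s => gauss_scale s y) a^-1) => //.
  by apply: measurable_gauss_scale_on => s /Dab; exact: ab_gt0.
by move=> s /Dab; exact: gauss_scale_le.
Qed.

Lemma mixture_ab_ereal m x : (mixture_pdf m G x)%:E =
  (\int[G]_(s in ab) (normal_peak 1 * gauss_scale s (x - m))%:E)%E.
Proof.
pose D := `]0, +oo[%classic : set (measurableTypeR R).
have mN : measurable (~` ab) by exact: measurableC.
have mD : measurable D by exact: measurable_itv.
have D0 : D `<=` [set s | 0 < s] by move=> s; rewrite /D/= in_itv/= andbT.
have abE : D `\` ~` ab = ab.
  rewrite setDE setCK; apply: setIidr => s /ab_gt0 s0.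
  by rewrite /D/= in_itv/= s0.
have ig : G.-integrable ab (fun s => (normal_peak 1 * gauss_scale s (x - m))%:E).
  exact: (integrableZl measurable_ab (normal_peak 1)
    (integrable_gauss_scale (x - m) measurable_ab (@subset_refl _ ab))).
rewrite /mixture_pdf /Rintegral -/D.
rewrite (eq_integral (fun s : measurableTypeR R => (normal_peak 1 * gauss_scale s (x - m))%:E)); last first.
  move=> s /set_mem/D0 s0; rewrite normal_pdf01 /gauss_scale.
  by congr EFin; rewrite mulrCA.
rewrite (ge0_negligible_integral mN mD _ _ Gab) ?abE ?fineK//.
- exact: (integrable_fin_num measurable_ab ig).
- apply/measurable_EFinP; apply: measurable_funM => //.
  exact: measurable_gauss_scale_on.
- by move=> s /D0 s0; rewrite lee_fin mulr_ge0 ?normal_peak_ge0// gauss_scale_ge0.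
Qed.

Lemma mixture_ab m x :
  mixture_pdf m G x = normal_peak 1 * \int[G]_(s in ab) gauss_scale s (x - m).
Proof.
rewrite -RintegralZl//; last exact: integrable_gauss_scale.
by rewrite /Rintegral -mixture_ab_ereal.
Qed.

Lemma measurable_normal_pdf_joint m : measurable_fun setT
  (fun z : measurableTypeR R * measurableTypeR R =>
     (normal_pdf m (expR (ln z.2)) z.1)%:E).
Proof.
apply/measurable_EFinP.
rewrite (_ : (fun _ => _) = (fun z : measurableTypeR R * measurableTypeR R =>
     normal_pdf 0 (expR (ln z.1)) z.2) \o (fun z => (z.2, z.1 - m))); last first.
  by apply/funext => z /=; rewrite !normal_pdf_scale ?expR_gt0// subr0.
apply: measurableT_comp; first exact: measurable_normal_pdf0_joint.
apply: measurable_fun_pair; first exact: measurable_snd.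
by apply: measurable_funB => //; exact: measurable_fst.
Qed.

Lemma mixture_ereal m x :
  (mixture_pdf m G x)%:E = (\int[G]_s (normal_pdf m (expR (ln s)) x)%:E)%E.
Proof.
have mN : measurable (~` ab) by exact: measurableC.
rewrite [RHS](ge0_negligible_integral mN _ _ _ Gab)//.
- rewrite setTD setCK mixture_ab_ereal; apply: eq_integral => s /set_mem/ab_gt0 s0.
  by rewrite lnK ?posrE// normal_pdf_scale.
- exact: (measurable_fun_pair2 x (measurable_normal_pdf_joint m)).
- by move=> s _; rewrite lee_fin normal_pdf_ge0.
Qed.

Lemma measurable_mixture m : measurable_fun setT (mixture_pdf m G).
Proof.
have := measurable_fun_fubini_tonelli_F (m2 := G) _ (measurable_normal_pdf_joint m).
have n0 (z : measurableTypeR R * measurableTypeR R) :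
    (0 <= (normal_pdf m (expR (ln z.2)) z.1)%:E)%E.
  by rewrite lee_fin normal_pdf_ge0.
move=> /(_ n0) h; apply/measurable_EFinP; congr (measurable_fun _ _) : h.
by apply/funext => x /=; rewrite mixture_ereal.
Qed.

Lemma integral_mixture m :
  (\int[lebesgue_measure]_x (mixture_pdf m G x)%:E = 1)%E.
Proof.
under eq_integral do rewrite mixture_ereal.
have n0 (z : measurableTypeR R * measurableTypeR R) :
    (0 <= (normal_pdf m (expR (ln z.2)) z.1)%:E)%E.
  by rewrite lee_fin normal_pdf_ge0.
rewrite (fubini_tonelli _ (measurable_normal_pdf_joint m) n0)/=.
under eq_integral do rewrite integral_normal_pdf.
by rewrite integral_cst// [X in (_ * X)%E](@probability_setT _ _ _ G) mul1e.
Qed.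

Lemma mixture_gt0 m x : a <= b -> 0 < mixture_pdf m G x.
Proof.
move=> ab_; rewrite mixture_ab; apply: mulr_gt0; first exact: normal_peak1_gt0.
pose c := b^-1 * expR (- ((x - m) / a) ^+ 2 / 2).
have c0 : 0 < c by rewrite mulr_gt0 ?expR_gt0// invr_gt0 (lt_le_trans a_gt0).
apply: (@lt_le_trans _ _ (\int[G]_(s in ab) c)).
  by rewrite Rintegral_cst// (_ : fine _ = 1) ?mulr1//; exact: (congr1 fine prob_ab).
apply: le_Rintegral => //.
- exact: finite_measure_integrable_cst.
- exact: integrable_gauss_scale.
move=> s abs; have s0 := ab_gt0 abs; move: abs.
rewrite /= in_itv/= => /andP[as_ sb]; rewrite /c /gauss_scale; apply: ler_pM.
- by rewrite invr_ge0 ltW// (lt_le_trans s0).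
- exact: expR_ge0.
- by rewrite lef_pV2// posrE (lt_le_trans s0).
rewrite ler_expR !mulNr lerN2 ler_pM2r// !expr_div_n.
rewrite ler_wpM2l ?sqr_ge0// lef_pV2 ?posrE ?exprn_gt0//.
by apply: lerXn2r; rewrite ?nnegrE ?(ltW a_gt0) ?(ltW s0).
Qed.

Lemma mixture_le m x M : 0 <= M ->
  (forall s, ab s -> gauss_scale s (x - m) <= M) -> mixture_pdf m G x <= M.
Proof.
move=> M0 gM; rewrite mixture_ab -[leRHS]mul1r.
have g0 s : ab s -> 0 <= gauss_scale s (x - m).
  by move=> /ab_gt0; exact: gauss_scale_ge0.
apply: ler_pM; [exact: normal_peak_ge0|exact: Rintegral_ge0|exact: normal_peak1_le1|].
apply: le_trans (ler_norm _) _; apply: abs_Rintegral_le => //.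
  by apply: measurable_gauss_scale_on; exact: ab_gt0.
by move=> s abs; rewrite ger0_norm ?g0// gM.
Qed.

Lemma mixture_dist_mean m m' x M : 0 <= M ->
  (forall s, ab s -> `|gauss_scale s (x - m) - gauss_scale s (x - m')| <= M) ->
  `|mixture_pdf m G x - mixture_pdf m' G x| <= M.
Proof.
move=> M0 gM; rewrite !mixture_ab -mulrBr -[leRHS]mul1r normrM.
rewrite -RintegralB//; try exact: integrable_gauss_scale.
apply: ler_pM => //.
  by rewrite ger0_norm ?normal_peak_ge0// normal_peak1_le1.
apply: abs_Rintegral_le => //.
by apply: measurable_funB; apply: measurable_gauss_scale_on; exact: ab_gt0.
Qed.

End mixture.


(** * The true mixture and its affinity with other densities *)
Section empirical_mixture.
Context (R : realType) (n : nat) (sigma : 'I_n -> R).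
Hypothesis n_gt0 : (0 < n)%N.

Let emp := empirical sigma.
Let emp1 : emp setT = 1%E. Proof. exact: empirical_setT. Qed.
HB.instance Definition _ := Measure.on emp.
HB.instance Definition _ := Measure_isProbability.Build _ _ _ emp emp1.

Definition empirical_prob : probability (measurableTypeR R) R := emp.

Lemma mixture_empirical_prob mu :
  mixture_pdf mu empirical_prob = mixture_pdf mu (empirical sigma).
Proof. by []. Qed.

Lemma ge0_integral_empirical (D : set (measurableTypeR R)) (g : R -> R) :
  measurable D -> measurable_fun D g -> (forall x, D x -> 0 <= g x) ->
  (forall i, D (sigma i)) ->
  (\int[empirical sigma]_(x in D) (g x)%:E =
   (n%:R^-1 * \sum_(i < n) g (sigma i))%:E)%E.
Proof.
move=> mD mg g0 Ds.
pose m k : {measure set (measurableTypeR R) -> \bar R} :=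
  @dirac _ (measurableTypeR R) (sigma (insubd (Ordinal n_gt0) k)) R.
have n0 : (0 <= n%:R^-1 :> R) by rewrite invr_ge0.
have E : (\int[empirical sigma]_(x in D) (g x)%:E =
    \int[mscale (NngNum n0) (msum m n)]_(x in D) (g x)%:E)%E.
  apply: eq_measure_integral => A mA AD.
  rewrite /= /empirical /mscale/= /msum; congr (_ * _)%E.
  by apply: eq_bigr => i _; rewrite /m valKd.
have mg' : measurable_fun D (EFin \o g) by exact/measurable_EFinP.
have g0' x : D x -> (0 <= (g x)%:E)%E by move=> /g0; rewrite lee_fin.
rewrite E ge0_integral_mscale// ge0_integral_measure_sum//.
rewrite EFinM -sumEFin; congr (_ * _)%E; apply: eq_bigr => i _.
by rewrite integral_dirac// valKd diracE mem_set// mul1e.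
Qed.

Lemma mixture_empirical (mu : R) : (forall i, 0 < sigma i) ->
  mixture_pdf mu (empirical sigma) =
  average_density (fun i => normal_pdf mu (sigma i)).
Proof.
move=> s0; apply/funext => x; rewrite /mixture_pdf /Rintegral.
have D0 : `]0, +oo[%classic `<=` [set s : R | 0 < s].
  by move=> s; rewrite /= in_itv/= andbT.
rewrite (eq_integral (fun s : measurableTypeR R =>
    (normal_peak 1 * gauss_scale s (x - mu))%:E)); last first.
  move=> s /set_mem/D0 sp; rewrite normal_pdf01 /gauss_scale.
  by congr EFin; rewrite mulrCA.
rewrite (ge0_integral_empirical (g := fun s => normal_peak 1 * gauss_scale s (x - mu)))//=.
- rewrite /average_density; congr (_ * _); apply: eq_bigr => i _.
  by rewrite normal_pdf_scale.
- by apply: measurable_funM => //; exact: measurable_gauss_scale_on.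
- by move=> s /D0 sp; rewrite mulr_ge0 ?normal_peak_ge0// gauss_scale_ge0.
- by move=> i; rewrite in_itv/= s0.
Qed.

Lemma supp_empirical (D : set R) : closed D -> (forall i, D (sigma i)) ->
  supp empirical_prob `<=` D.
Proof.
move=> cD Ds x sx; apply: contrapT => Dx.
have := sx (~` D) (closed_openC cD) Dx; rewrite [X in (_ < X)%E](_ : _ = 0%E) ?ltxx//.
apply: (etrans (_ : _ = (n%:R^-1)%:E * \sum_(i < n) \d_(sigma i) (~` D))%E); first by [].
rewrite big1 ?mule0// => i _; rewrite diracE memNset//= => h; exact: h.
Qed.

End empirical_mixture.

Section hellinger.
Context (R : realType).
Notation mu := (@lebesgue_measure R).
Implicit Types f g : R -> R.

(** The expansion of the square reads H^2 + 2 * affinity = 2 with nonnegative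
    terms, which also shows that the affinity is finite. *)
Lemma integral_affinity f g :
  measurable_fun setT f -> measurable_fun setT g ->
  (forall x, 0 <= f x) -> (forall x, 0 <= g x) ->
  (\int[mu]_x (f x)%:E = 1)%E -> (\int[mu]_x (g x)%:E = 1)%E ->
  exists a : R, (\int[mu]_x (Num.sqrt (f x * g x))%:E = a%:E)%E /\
    hellinger2 g f = (2 - 2 * a)%:E.
Proof.
move=> mf mg f0 g0 f1 g1.
have mfg : measurable_fun setT (fun x => Num.sqrt (f x * g x)).
  by apply: measurable_sqrtr_comp; exact: measurable_funM.
have msf : measurable_fun setT (fun x => (Num.sqrt (g x) - Num.sqrt (f x)) ^+ 2).
  by apply: measurable_funX; apply: measurable_funB; exact: measurable_sqrtr_comp.
have E : (hellinger2 g f + 2%:E * \int[mu]_x (Num.sqrt (f x * g x))%:E = 2%:E)%E.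
  rewrite -ge0_integralZl//; last exact/measurable_EFinP.
  rewrite /hellinger2 -ge0_integralD//;
    try (by move=> x _; rewrite lee_fin sqr_ge0);
    try (by move=> x _; rewrite -EFinM lee_fin mulr_ge0 ?sqrtr_ge0);
    try (by apply/measurable_EFinP; rewrite ?EFinM//; exact: measurable_funM).
  transitivity (\int[mu]_x ((f x)%:E + (g x)%:E))%E.
    apply: eq_integral => x _; rewrite -EFinM -!EFinD; congr EFin.
    rewrite sqrtrM// sqrrB !sqr_sqrtr//; ring.
  rewrite ge0_integralD//; try exact/measurable_EFinP;
    try (by move=> x _; rewrite lee_fin).
  by rewrite f1 g1 -EFinD.
have H0 : (0 <= hellinger2 g f)%E.
  by apply: integral_ge0 => x _; rewrite lee_fin sqr_ge0.
have A0 : (0 <= \int[mu]_x (Num.sqrt (f x * g x))%:E)%E.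
  by apply: integral_ge0 => x _; rewrite lee_fin sqrtr_ge0.
move: E H0 A0; case: hellinger2 => [h| |]//; case: (integral _ _ _) => [a| |]//.
  move=> E _ _; exists a; split => //; congr EFin.
  by have := EFin_inj (E : (h + 2 * a)%:E = 2%:E); lra.
- by rewrite gt0_muley ?lte_fin.
- by rewrite gt0_muley ?lte_fin.
Qed.

End hellinger.


Section envelope.
Context (R : realType) (n : nat) (a b mu : R) (sigma : 'I_n -> R).
Hypothesis n_gt0 : (0 < n)%N.
Hypothesis a_gt0 : 0 < a.
Hypothesis sigma_ab : forall i, a <= sigma i <= b.
Notation leb := (@lebesgue_measure R).

(** sqrt (weight * fbar) still decays, like exp (- (x - mu)^2 / (8 b^2)); see
    [weight_average_le].  The growth of the weight is what lets a small multiple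
    of it dominate every mixture with a remote center. *)
Definition weight (x : R) : R := expR ((x - mu) ^+ 2 / (4 * b ^+ 2)).
(** Chosen so that sqrt (2 * net_tolerance) times the bound in
    [integral_sqrt_weight] equals 1 / n. *)
Definition net_tolerance : R := normal_peak 1 * a / (8 * (b * n%:R) ^+ 2).

Let fbar := average_density (fun i => normal_pdf mu (sigma i)).

Lemma sigma_gt0 i : 0 < sigma i.
Proof. by have /andP[+ _] := sigma_ab i; exact: lt_le_trans. Qed.

Let b_gt0 : 0 < b.
Proof.
by have /andP[h1 h2] := sigma_ab (Ordinal n_gt0); exact: lt_le_trans (lt_le_trans a_gt0 h1) h2.
Qed.

Lemma measurable_weight : measurable_fun setT weight.
Proof.
apply: measurableT_comp => //; apply: measurable_funM => //.
by apply: measurable_funX; exact: measurable_funB.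
Qed.

Lemma weight_average_le x :
  weight x * fbar x <= normal_peak 1 / a * expR (- (x - mu) ^+ 2 / (4 * b ^+ 2)).
Proof.
have c0 := normal_peak1_gt0 R.
rewrite /fbar /average_density mulrCA mulr_sumr.
rewrite ler_pdivrMl ?ltr0n//.
apply: (@le_trans _ _ (\sum_(i < n) (normal_peak 1 / a *
    expR (- (x - mu) ^+ 2 / (4 * b ^+ 2))))); last first.
  by rewrite sumr_const card_ord [leRHS]mulr_natl.
apply: ler_sum => i _; have si := sigma_gt0 i.
have /andP[asi sib] := sigma_ab i.
rewrite normal_pdf_scale// /gauss_scale /weight.
rewrite mulrCA -mulrA ler_pM2l// mulrCA -expRD.
apply: ler_pM;  rewrite ?invr_ge0 ?expR_ge0 ?(ltW si)//.
  by rewrite lef_pV2.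
rewrite ler_expR expr_div_n !mulNr.
set t := (x - mu) ^+ 2; have t0 : 0 <= t by exact: sqr_ge0.
have : t / b ^+ 2 <= t / sigma i ^+ 2.
  rewrite ler_wpM2l// lef_pV2 ?posrE ?exprn_gt0//.
  by apply: lerXn2r; rewrite ?nnegrE ?(ltW si) ?(ltW b_gt0).
have -> : t / (4 * b ^+ 2) = t / b ^+ 2 / 4 by field; rewrite gt_eqF.
by move: (t / b ^+ 2) (t / sigma i ^+ 2) => u v; lra.
Qed.

(** The square root of the bound in [weight_average_le] is a multiple of the
    normal density with standard deviation 2 b. *)
Lemma integral_sqrt_weight :
  (\int[leb]_x (Num.sqrt (weight x * fbar x))%:E <=
   (2 * b / Num.sqrt (normal_peak 1 * a))%:E)%E.
Proof.
have c0 := normal_peak1_gt0 R.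
pose k := 2 * b / Num.sqrt (normal_peak 1 * a).
have k0 : 0 <= k by rewrite divr_ge0 ?sqrtr_ge0// mulr_ge0// ltW.
apply: (@le_trans _ _ (\int[leb]_x (k%:E * (normal_pdf mu (2 * b) x)%:E)))%E; last first.
  rewrite ge0_integralZl//;
    try (by apply/measurable_EFinP; exact: measurable_normal_pdf);
    try (by move=> x _; rewrite lee_fin normal_pdf_ge0).
  by rewrite integral_normal_pdf mule1.
have mfb : measurable_fun setT fbar.
  by apply: measurable_average => i; exact: measurable_normal_pdf.
apply: ge0_le_integral => //.
- apply/measurable_EFinP; apply: measurable_sqrtr_comp; apply: measurable_funM => //.
  exact: measurable_weight.
- by apply/measurable_EFinP; apply: measurable_funM => //; exact: measurable_normal_pdf.
move=> x _; rewrite -EFinM lee_fin.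
apply: (le_trans (ler_wsqrtr (weight_average_le x))).
rewrite normal_pdf_scale ?mulr_gt0// /gauss_scale /k.
set c := normal_peak 1; set s := Num.sqrt (c * a).
have s0 : 0 < s by rewrite sqrtr_gt0 mulr_gt0.
have sE : s ^+ 2 = c * a by rewrite sqr_sqrtr// ltW// mulr_gt0.
have -> : Num.sqrt (c / a * expR (- (x - mu) ^+ 2 / (4 * b ^+ 2))) =
    c / s * expR (- ((x - mu) / (2 * b)) ^+ 2 / 2).
  rewrite -[RHS]ger0_norm ?mulr_ge0 ?invr_ge0 ?expR_ge0 ?(ltW s0) ?(ltW c0)//.
  rewrite -sqrtr_sqr; congr Num.sqrt; rewrite exprMn expr_div_n sE -expRM_natl.
  congr (_ * expR _); first by field; rewrite ?gt_eqF.
  by field; rewrite gt_eqF.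
rewrite le_eqVlt; apply/orP; left; apply/eqP.
by field; rewrite !gt_eqF.
Qed.

Lemma sqrtrD_le (u v : R) : 0 <= u -> 0 <= v ->
  Num.sqrt (u + v) <= Num.sqrt u + Num.sqrt v.
Proof.
move=> u0 v0; rewrite -[leRHS]ger0_norm ?addr_ge0 ?sqrtr_ge0// -sqrtr_sqr.
rewrite ler_wsqrtr// sqrrD !sqr_sqrtr// -addrA [_ *+ 2 + _]addrC addrA lerDl.
by rewrite mulrn_wge0// mulr_ge0 ?sqrtr_ge0.
Qed.

Lemma average_ge0 x : 0 <= fbar x.
Proof.
rewrite /fbar /average_density mulr_ge0 ?invr_ge0// sumr_ge0// => i _.
exact: normal_pdf_ge0.
Qed.

(** By subadditivity of the square root, an increase of a density by
    2 * net_tolerance * weight increases its affinity by at most 1 / n. *)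
Lemma affinity_envelope (q f : R -> R) (alpha : R) :
  measurable_fun setT q -> measurable_fun setT f ->
  (forall x, 0 <= q x) -> (forall x, 0 <= f x) ->
  (forall x, q x <= f x + 2 * net_tolerance * weight x) ->
  (\int[leb]_x (Num.sqrt (f x * fbar x))%:E = alpha%:E)%E ->
  exists c : R, (\int[leb]_x (Num.sqrt (q x * fbar x))%:E = c%:E)%E /\
    c <= alpha + n%:R^-1.
Proof.
move=> mq mf q0 f0 qf fa.
have c0 := normal_peak1_gt0 R.
have n0 : 0 < n%:R :> R by rewrite ltr0n.
have e0 : 0 <= 2 * net_tolerance.
  by rewrite /net_tolerance mulr_ge0// divr_ge0 ?mulr_ge0 ?sqr_ge0 ?ltW.
have w0 x : 0 <= weight x by exact: expR_ge0.
have mfb : measurable_fun setT fbar.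
  by apply: measurable_average => i; exact: measurable_normal_pdf.
pose r := Num.sqrt (2 * net_tolerance).
have le : (\int[leb]_x (Num.sqrt (q x * fbar x))%:E <= (alpha + n%:R^-1)%:E)%E.
  apply: (@le_trans _ _ (\int[leb]_x ((Num.sqrt (f x * fbar x))%:E +
      r%:E * (Num.sqrt (weight x * fbar x))%:E))%E).
    have m1 : measurable_fun setT (fun x => Num.sqrt (q x * fbar x)).
      by apply: measurable_sqrtr_comp; exact: measurable_funM.
    have m2 : measurable_fun setT (fun x => Num.sqrt (f x * fbar x)).
      by apply: measurable_sqrtr_comp; exact: measurable_funM.
    have m3 : measurable_fun setT (fun x => Num.sqrt (weight x * fbar x)).
      apply: measurable_sqrtr_comp; apply: measurable_funM => //.
      exact: measurable_weight.
    apply: ge0_le_integral => //.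
    - exact/measurable_EFinP.
    - by apply/measurable_EFinP; apply: measurable_funD => //; exact: measurable_funM.
    move=> x _; rewrite -EFinM -EFinD lee_fin.
    apply: (@le_trans _ _ (Num.sqrt ((f x + 2 * net_tolerance * weight x) * fbar x))).
      by rewrite ler_wsqrtr// ler_wpM2r// average_ge0.
    rewrite mulrDl; apply: (le_trans (sqrtrD_le _ _)).
    - by apply: mulr_ge0 => //; exact: average_ge0.
    - by apply: mulr_ge0; [exact: mulr_ge0|exact: average_ge0].
    - by rewrite lerD2l -mulrA sqrtrM.
  have m2 : measurable_fun setT (fun x => Num.sqrt (f x * fbar x)).
    by apply: measurable_sqrtr_comp; exact: measurable_funM.
  have m3 : measurable_fun setT (fun x => Num.sqrt (weight x * fbar x)).
    apply: measurable_sqrtr_comp; apply: measurable_funM => //.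
    exact: measurable_weight.
  rewrite ge0_integralD//; try exact/measurable_EFinP;
    try (by move=> x _; rewrite -EFinM lee_fin mulr_ge0 ?sqrtr_ge0);
    try (by apply/measurable_EFinP; exact: measurable_funM).
  rewrite fa EFinD leeD2l// ge0_integralZl ?lee_fin ?sqrtr_ge0//;
    try exact/measurable_EFinP.
  apply: (@le_trans _ _ (r%:E * (2 * b / Num.sqrt (normal_peak 1 * a))%:E)%E).
    by apply: lee_wpmul2l; [rewrite lee_fin sqrtr_ge0|exact: integral_sqrt_weight].
  rewrite -EFinM lee_fin le_eqVlt; apply/orP; left; apply/eqP.
  set s := Num.sqrt (normal_peak 1 * a).
  have s0 : 0 < s by rewrite sqrtr_gt0 mulr_gt0.
  have -> : r = s / (2 * b * n%:R).
    rewrite -[RHS]ger0_norm ?divr_ge0 ?mulr_ge0 ?(ltW s0) ?(ltW b_gt0)//.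
    rewrite /r -sqrtr_sqr; congr Num.sqrt.
    rewrite expr_div_n sqr_sqrtr ?mulr_ge0 ?(ltW c0) ?(ltW a_gt0)// /net_tolerance.
    by field; rewrite !gt_eqF.
  by field; rewrite !gt_eqF.
have int0 : (0 <= \int[leb]_x (Num.sqrt (q x * fbar x))%:E)%E.
  by apply: integral_ge0 => x _; rewrite lee_fin sqrtr_ge0.
exists (fine (\int[leb]_x (Num.sqrt (q x * fbar x))%:E)%E).
have fin : (\int[leb]_x (Num.sqrt (q x * fbar x))%:E)%E \is a fin_num.
  by rewrite ge0_fin_numE//; apply: le_lt_trans le (ltry _).
by rewrite fineK//; split => //; rewrite -lee_fin fineK.
Qed.

End envelope.


(** * Taylor expansion of the exponential *)
Section exponential.
Context (R : realType).
Implicit Types x y : R.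

Lemma expR1_ge2 : 2 <= expR 1 :> R.
Proof. by apply: le_trans (expR_ge1Dx 1); lra. Qed.

Lemma expR1_le4 : expR 1 <= 4 :> R.
Proof.
have h : 2^-1 <= expR (- 2^-1) :> R by apply: le_trans (expR_ge1Dx _); lra.
have h2 : expR 2^-1 <= 2 :> R.
  by rewrite -[leRHS]invrK -[leLHS]invrK -expRN lef_pV2 ?posrE ?expR_gt0 ?invr_gt0.
have -> : expR 1 = expR 2^-1 * expR 2^-1 :> R by rewrite -expRD; congr expR; lra.
apply: (@le_trans _ _ (2 * 2)); last by lra.
by apply: ler_pM; rewrite ?expR_ge0.
Qed.

Lemma exp_partial_le x N : 0 <= x -> \sum_(i < N) x ^+ i / i`!%:R <= expR x.
Proof.
move=> x0.
suff nd : nondecreasing_seq (series (exp_coeff x)).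
  have := nondecreasing_cvgn_le nd (@is_cvg_series_exp_coeff R x) N.
  by rewrite /series/= big_mkord.
apply/nondecreasing_seqP => k; rewrite /series/= big_nat_recr//= lerDl.
exact: exp_coeff_ge0.
Qed.

(** The remainder is at most the sum of the x ^ i / i! over i >= K, and inserting
    the factor 16 ^ i / 16 ^ K >= 1 turns it into a part of the series of
    exp (16 x).  The bound is therefore exponentially small in K as soon as K is
    a large enough multiple of x. *)
Lemma exp_taylor x K : 0 <= x ->
  `|expR (- x) - \sum_(i < K) (- x) ^+ i / i`!%:R| <= (16 ^+ K)^-1 * expR (16 * x).
Proof.
move=> x0; set S := \sum_(i < K) _; set B := _ * _.
have part N : (K <= N)%N -> `|series (exp_coeff (- x)) N - S| <= B.
  move=> KN; rewrite /series/= (big_cat_nat _ KN)//=.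
  have -> : \sum_(0 <= i < K) exp_coeff (- x) i = S by rewrite big_mkord.
  rewrite addrAC subrr add0r.
  apply: (le_trans (ler_norm_sum _ _ _)).
  apply: (@le_trans _ _ (\sum_(K <= i < N) (16 ^+ K)^-1 * ((16 * x) ^+ i / i`!%:R))).
    rewrite big_nat [leRHS]big_nat; apply: ler_sum => i /andP[Ki _].
    rewrite /exp_coeff normrM normrX normrN (ger0_norm x0) ger0_norm ?invr_ge0//.
    rewrite mulrA; apply: ler_wpM2r; first by rewrite invr_ge0.
    rewrite exprMn mulrA; apply: ler_peMl; first exact: exprn_ge0.
    by rewrite ler_pdivlMl ?exprn_gt0// mulr1 ler_weXn2l//; lra.
  rewrite -mulr_sumr; apply: ler_wpM2l; first by rewrite invr_ge0 exprn_ge0.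
  apply: le_trans (exp_partial_le N _); last by rewrite mulr_ge0.
  rewrite -[leRHS](big_mkord xpredT (fun i => (16 * x) ^+ i / i`!%:R)).
  rewrite [leRHS](big_cat_nat _ KN)//= lerDr sumr_ge0// => i _.
  by rewrite divr_ge0// exprn_ge0// mulr_ge0.
have cv : (`|series (exp_coeff (- x)) N - S| @[N --> \oo] --> `|expR (- x) - S|).
  apply: cvg_norm; apply: cvgB; last exact: cvg_cst.
  exact: is_cvg_series_exp_coeff.
apply: (cvgr_to_le cv).
by exists K => // N /= KN; exact: part.
Qed.

End exponential.


(** * Mixtures with scales in one dyadic interval *)
Section one_scale.
Context (R : realType) (alpha : R) (D : set (measurableTypeR R)).
Hypothesis alpha_gt0 : 0 < alpha.
Hypothesis mD : measurable D.
Hypothesis Dalpha : forall s, D s -> alpha <= s < 2 * alpha.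
Implicit Types G : probability (measurableTypeR R) R.

Let D_gt0 s : D s -> 0 < s.
Proof. by move=> /Dalpha /andP[+ _]; exact: lt_le_trans. Qed.

(** Only odd exponents occur, because the kernel is a multiple of
    t exp (- z t^2) in the ratio t = alpha / s. *)
Definition moment G (i : nat) : R := \int[G]_(s in D) (alpha / s) ^+ (2 * i).+1.

Let ratio_bounds s : D s -> 2^-1 <= alpha / s <= 1.
Proof.
move=> Ds; have s0 := D_gt0 Ds; have /andP[h1 h2] := Dalpha Ds.
rewrite ler_pdivlMr// ler_pdivrMr// mul1r h1 andbT.
by rewrite mulrC ler_pdivrMr// mulrC ltW.
Qed.

Let measurable_ratioX i : measurable_fun D (fun s : R => (alpha / s) ^+ i).
Proof.
apply: (eq_measurable_fun (fun s => (alpha * expR (- ln s)) ^+ i)).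
  by move=> s /set_mem /D_gt0 s0; rewrite expRN lnK ?posrE.
apply: measurable_funTS; apply: measurable_funX; apply: measurable_funM => //.
apply: measurableT_comp => //; apply: measurable_funN; exact: measurable_ln.
Qed.

Let ratioX_le1 i s : D s -> `|(alpha / s) ^+ i| <= 1.
Proof.
move=> /ratio_bounds /andP[h1 h2].
have t0 : 0 <= alpha / s by apply: le_trans h1; rewrite invr_ge0.
by rewrite ger0_norm ?exprn_ge0// exprn_ile1.
Qed.

Let integrable_ratioX G i : G.-integrable D (fun s => ((alpha / s) ^+ i)%:E).
Proof.
apply: (@bounded_integrable _ _ _ (fun s => (alpha / s) ^+ i) 1) => //.
exact: ratioX_le1.
Qed.

Lemma moment_bounds G i : 0 <= moment G i <= 1.
Proof.
apply/andP; split.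
  apply: Rintegral_ge0 => s Ds; rewrite exprn_ge0// divr_ge0 ?ltW//.
  exact: D_gt0.
apply: le_trans (ler_norm _) _; apply: abs_Rintegral_le => //.
exact: ratioX_le1.
Qed.

Let measurable_gauss y : measurable_fun D (fun s : R => gauss_scale s y).
Proof. by apply: measurable_gauss_scale_on; exact: D_gt0. Qed.

Let gauss_ratio s y : D s -> gauss_scale s y =
  alpha^-1 * (alpha / s * expR (- (y ^+ 2 / (2 * alpha ^+ 2) * (alpha / s) ^+ 2))).
Proof.
move=> Ds; have s0 := D_gt0 Ds; rewrite /gauss_scale mulrA mulrA mulVf ?gt_eqF// mul1r.
by congr (_ * expR _); field; rewrite !gt_eqF.
Qed.

(** The ratio t is at least 1 / 2, so that z t^2 >= z / 4. *)
Lemma scale_far G y Z : Z <= y ^+ 2 / (2 * alpha ^+ 2) ->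
  `| \int[G]_(s in D) gauss_scale s y | <= alpha^-1 * expR (- (Z / 4)).
Proof.
move=> Zy; apply: abs_Rintegral_le => //.
  by rewrite mulr_ge0 ?expR_ge0// invr_ge0 ltW.
move=> s Ds; have s0 := D_gt0 Ds.
rewrite ger0_norm ?gauss_scale_ge0// gauss_ratio//.
have /andP[h1 h2] := ratio_bounds Ds.
set t := alpha / s in h1 h2 *; set z := _ / (2 * _) in Zy *.
have z0 : 0 <= z by rewrite divr_ge0 ?sqr_ge0// mulr_ge0// sqr_ge0.
apply: ler_wpM2l; first by rewrite invr_ge0 ltW.
rewrite -[leRHS]mul1r; apply: ler_pM; rewrite ?expR_ge0//; first by lra.
rewrite ler_expR lerN2; apply: (@le_trans _ _ (z / 4)).
  by rewrite ler_pM2r.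
by apply: ler_wpM2l => //; nra.
Qed.

(** Integrating the Taylor polynomial of exp (- z t^2) term by term, after
    multiplication by t, leaves a combination of moments. *)
Lemma scale_taylor G y Z K : y ^+ 2 / (2 * alpha ^+ 2) <= Z ->
  `| alpha * \int[G]_(s in D) gauss_scale s y -
     \sum_(i < K) (- (y ^+ 2 / (2 * alpha ^+ 2))) ^+ i / i`!%:R * moment G i |
  <= (16 ^+ K)^-1 * expR (16 * Z).
Proof.
move=> yZ; set z := y ^+ 2 / _ in yZ *.
have z0 : 0 <= z by rewrite divr_ge0 ?sqr_ge0// mulr_ge0// sqr_ge0.
pose c (i : nat) := (- z) ^+ i / i`!%:R.
have igs : G.-integrable D (fun s => (gauss_scale s y)%:E).
  apply: (@bounded_integrable _ _ _ (fun s => gauss_scale s y) alpha^-1) => //.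
  move=> s Ds; have s0 := D_gt0 Ds; rewrite ger0_norm ?gauss_scale_ge0//.
  have /andP[h1 h2] := Dalpha Ds.
  rewrite /gauss_scale -[leRHS]mulr1; apply: ler_pM.
  - by rewrite invr_ge0 ltW.
  - exact: expR_ge0.
  - by rewrite lef_pV2.
  - by rewrite -expR0 ler_expR mulNr oppr_le0 divr_ge0// sqr_ge0.
have isum : G.-integrable D (fun s => (\sum_(i < K) c i * (alpha / s) ^+ (2 * i).+1)%:E).
  under eq_fun do rewrite -sumEFin.
  apply: integrable_sum => // i _.
  exact: (integrableZl mD (c i) (integrable_ratioX G (2 * i).+1)).
have Esum : \sum_(i < K) c i * moment G i =
    \int[G]_(s in D) (\sum_(i < K) c i * (alpha / s) ^+ (2 * i).+1).
  apply: EFin_inj; rewrite /Rintegral fineK; last exact: integrable_fin_num.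
  under [RHS]eq_integral do rewrite -sumEFin.
  rewrite integral_sum//; last first.
    move=> i; exact: (integrableZl mD (c i) (integrable_ratioX G (2 * i).+1)).
  rewrite -sumEFin; apply: eq_bigr => i _.
  rewrite /moment -RintegralZl//; last exact: (integrable_ratioX G (2 * i).+1).
  rewrite /Rintegral fineK//; apply: integrable_fin_num => //.
  exact: (integrableZl mD (c i) (integrable_ratioX G (2 * i).+1)).
rewrite -/c Esum -RintegralZl//.
have iags : G.-integrable D (fun s => (alpha * gauss_scale s y)%:E).
  exact: (integrableZl mD alpha igs).
rewrite -RintegralB//; apply: abs_Rintegral_le => //.
- apply: measurable_funB; first exact: measurable_funM.
  by apply: measurable_sum => i; apply: measurable_funM.
move=> s Ds; rewrite gauss_ratio// -/z mulrA divff ?gt_eqF// mul1r.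
have /andP[h1 h2] := ratio_bounds Ds.
set t := alpha / s in h1 h2 *.
have t0 : 0 <= t by lra.
have -> : \sum_(i < K) c i * t ^+ (2 * i).+1 =
    t * \sum_(i < K) (- (z * t ^+ 2)) ^+ i / i`!%:R.
  rewrite mulr_sumr; apply: eq_bigr => i _; rewrite /c.
  move: (i : nat) => k; clearbody t z.
  by rewrite -mulNr (exprMn k) -exprM exprS; ring.
rewrite -mulrBr normrM (ger0_norm t0) -[leRHS]mul1r; apply: ler_pM => //.
have zt : z * t ^+ 2 <= z.
  by rewrite ler_piMr// exprn_ile1.
apply: (le_trans (exp_taylor _ _)); first by rewrite mulr_ge0// sqr_ge0.
apply: ler_wpM2l; first by rewrite invr_ge0 exprn_ge0.
by rewrite ler_expR ler_pM2l//; exact: le_trans zt yZ.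
Qed.

(** The coefficients z ^ i / i! of the moments add up to at most exp Z, whatever
    the number of terms. *)
Lemma scale_near G G' y Z K eta : y ^+ 2 / (2 * alpha ^+ 2) <= Z -> 0 <= eta ->
  (forall i, (i < K)%N -> `|moment G i - moment G' i| <= eta) ->
  `| \int[G]_(s in D) gauss_scale s y - \int[G']_(s in D) gauss_scale s y | <=
   alpha^-1 * (expR Z * eta + 2 * ((16 ^+ K)^-1 * expR (16 * Z))).
Proof.
move=> yZ eta0 mm.
have h := scale_taylor G K yZ; have h' := scale_taylor G' K yZ.
set z := y ^+ 2 / _ in yZ h h' *.
have z0 : 0 <= z by rewrite divr_ge0 ?sqr_ge0// mulr_ge0// sqr_ge0.
set I := \int[G]_(s in D) _ in h *; set I' := \int[G']_(s in D) _ in h' *.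
set S := \sum_(i < K) _ in h; set S' := \sum_(i < K) _ in h'.
have SS : `|S - S'| <= expR Z * eta.
  rewrite -sumrB; apply: (le_trans (ler_norm_sum _ _ _)).
  apply: (@le_trans _ _ (\sum_(i < K) z ^+ i / i`!%:R * eta)).
    apply: ler_sum => i _; rewrite -mulrBr normrM; apply: ler_pM => //; last exact: mm.
    by rewrite normrM normrX normrN (ger0_norm z0) ger0_norm ?invr_ge0.
  rewrite -mulr_suml ler_wpM2r//; apply: (le_trans (exp_partial_le _ z0)).
  by rewrite ler_expR.
rewrite ler_pdivlMl//.
have -> : alpha * `|I - I'| = `|alpha * I - alpha * I'|.
  by rewrite -(mulrBr alpha I I') normrM (gtr0_norm alpha_gt0).
have -> : alpha * I - alpha * I' = (alpha * I - S) - (alpha * I' - S') + (S - S') by ring.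
apply: (le_trans (ler_normD _ _)); have := ler_normB (alpha * I - S) (alpha * I' - S').
set B := _^-1 * _ in h h' *.
lra.
Qed.

End one_scale.


(** * Perturbation of the mixing law and of the center *)
Section scales.
Context (R : realType) (a b : R).
Hypothesis a_gt0 : 0 < a.
Hypothesis ab_le : a <= b.
Implicit Types G : probability (measurableTypeR R) R.
Notation ab := (`[a, b]%classic : set (measurableTypeR R)).

Definition dyadic j : set (measurableTypeR R) :=
  ab `&` `[a * 2 ^+ j, a * 2 ^+ j.+1[%classic.

Lemma measurable_dyadic j : measurable (dyadic j).
Proof. by apply: measurableI; exact: measurable_itv. Qed.
#[local] Hint Resolve measurable_dyadic : core.

Lemma dyadic_ratio j s : dyadic j s -> a * 2 ^+ j <= s < 2 * (a * 2 ^+ j).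
Proof. by move=> [_ /=]; rewrite in_itv/= exprS mulrCA. Qed.

Lemma dyadic_start_gt0 j : 0 < a * 2 ^+ j :> R.
Proof. by rewrite mulr_gt0// exprn_gt0. Qed.

Lemma Rintegral_dyadic G y J : b < a * 2 ^+ J ->
  \int[G]_(s in ab) gauss_scale s y =
  \sum_(j < J) \int[G]_(s in dyadic j) gauss_scale s y.
Proof.
move=> bJ; pose U k : set (measurableTypeR R) := ab `&` `[a, a * 2 ^+ k[%classic.
have mU k : measurable (U k) by apply: measurableI; exact: measurable_itv.
have -> : ab = U J.
  apply/esym/setIidl => s /=; rewrite !in_itv/= => /andP[-> sb].
  exact: le_lt_trans sb bJ.
elim: J {bJ} => [|J IH].
  rewrite big_ord0 (_ : U 0%N = set0) ?Rintegral_set0//.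
  by rewrite /U expr0 mulr1 set_itvco0 setI0.
rewrite big_ord_recr/= -IH.
have -> : U J.+1 = U J `|` dyadic J.
  rewrite /U /dyadic -setIUr; congr (_ `&` _).
  have h1 : a <= a * 2 ^+ J by rewrite ler_peMr ?(ltW a_gt0)// exprn_ege1//; lra.
  have h2 : a * 2 ^+ J <= a * 2 ^+ J.+1.
    by rewrite ler_pM2l// exprS ler_peMl ?exprn_ge0//; lra.
  apply/seteqP; split=> s /=; rewrite !in_itv/=.
    by move=> /andP[-> ->]; rewrite andbT/=; case: ltP => _; [left|right].
  by move=> [/andP[-> sJ]|/andP[sJ ->]]/=; rewrite ?andbT;
    [exact: lt_le_trans sJ h2|exact: le_trans h1 sJ].
rewrite Rintegral_setU//.
- apply: (integrable_gauss_scale G a_gt0 (b := b)); first exact: measurableU.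
  by move=> s [[]|[]].
- apply/disj_set2P/seteqP; split=> // s [[_ /=]]; rewrite in_itv/= => /andP[_ h1].
  by move=> [_ /=]; rewrite in_itv/= leNgt h1.
Qed.

(** At a given point, some dyadic intervals are in the range of the Taylor
    expansion; on the others both mixtures are negligible. *)
Lemma mixture_dist_moments G G' m x Z K J eta :
  G (~` ab) = 0 -> G' (~` ab) = 0 -> b < a * 2 ^+ J -> 0 <= eta ->
  (forall j i, (j < J)%N -> (i < K)%N ->
    `|moment (a * 2 ^+ j) (dyadic j) G i - moment (a * 2 ^+ j) (dyadic j) G' i|
      <= eta) ->
  `|mixture_pdf m G x - mixture_pdf m G' x| <=
  J%:R * (a^-1 * (expR Z * eta + 2 * ((16 ^+ K)^-1 * expR (16 * Z)) +
     2 * expR (- (Z / 4)))).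
Proof.
move=> Gab Gab' bJ eta0 mm.
rewrite (mixture_ab a_gt0 Gab) (mixture_ab a_gt0 Gab') -mulrBr normrM.
rewrite ger0_norm ?normal_peak_ge0//.
set B := expR Z * eta + 2 * _; set F := expR (- (Z / 4)).
have B0 : 0 <= B.
  by rewrite addr_ge0 ?mulr_ge0 ?expR_ge0// invr_ge0 exprn_ge0.
have F0 : 0 <= F by exact: expR_ge0.
rewrite -[leRHS]mul1r; apply: ler_pM; rewrite ?normal_peak_ge0 ?normal_peak1_le1//.
rewrite !(Rintegral_dyadic _ _ bJ) -sumrB.
apply: (le_trans (ler_norm_sum _ _ _)).
rewrite (_ : J%:R * _ = \sum_(j < J) (a^-1 * (B + 2 * F))); last first.
  by rewrite sumr_const card_ord mulr_natl.
apply: ler_sum => j _.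
set y := x - m; set alpha := a * 2 ^+ j.
have al0 : 0 < alpha by exact: dyadic_start_gt0.
have ala : alpha^-1 <= a^-1.
  rewrite lef_pV2// /alpha ler_peMr ?(ltW a_gt0)// exprn_ege1//; lra.
have [yZ|Zy] := leP (y ^+ 2 / (2 * alpha ^+ 2)) Z.
  have h := scale_near al0 (measurable_dyadic j) (@dyadic_ratio j)
    yZ eta0 (fun i iK => mm j i (ltn_ord j) iK).
  apply: (le_trans h); apply: ler_pM => //; first by rewrite invr_ge0 ltW.
  by rewrite lerDl mulr_ge0.
have far G0 := scale_far al0 (measurable_dyadic j) (@dyadic_ratio j) G0 (ltW Zy).
apply: (le_trans (ler_normB _ _)); apply: (le_trans (lerD (far G) (far G'))).
rewrite -/F -mulrDr; apply: ler_pM => //; first by rewrite invr_ge0 ltW.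
  by rewrite addr_ge0.
by lra.
Qed.

(** For 0 <= p <= q = p + d, with A = exp (- p^2 / 2), the difference is
    A (1 - exp (- d (p + d / 2))) <= d (A p) + A d^2 / 2, where A p <= 1; and when
    d >= 2 the claim is trivial. *)
Lemma gauss_lipschitz (u v : R) :
  `|expR (- u ^+ 2 / 2) - expR (- v ^+ 2 / 2)| <= 2 * `|u - v|.
Proof.
suff key (p q : R) : 0 <= p -> p <= q ->
    `|expR (- p ^+ 2 / 2) - expR (- q ^+ 2 / 2)| <= 2 * (q - p).
  rewrite -(real_normK (num_real u)) -(real_normK (num_real v)).
  have := ler_dist_dist u v; have [uv|vu] := leP `|u| `|v|.
    rewrite (@ler0_norm _ (`|u| - `|v|)) ?subr_le0// => h; apply: (le_trans (key _ _ _ uv)) => //.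
    lra.
  rewrite (@ger0_norm _ (`|u| - `|v|)) ?subr_ge0 ?(ltW vu)// => h; rewrite distrC.
  by apply: (le_trans (key _ _ _ (ltW vu))) => //; lra.
move=> p0 pq; set d := q - p; have d0 : 0 <= d by rewrite subr_ge0.
set A := expR (- p ^+ 2 / 2); set C := expR (- q ^+ 2 / 2).
have A0 : 0 < A by exact: expR_gt0.
have C0 : 0 < C by exact: expR_gt0.
have A1 : A <= 1 by rewrite /A -expR0 ler_expR mulNr oppr_le0 divr_ge0// sqr_ge0.
have CA : C <= A.
  by rewrite /A /C ler_expR !mulNr lerN2 ler_pM2r// lerXn2r ?nnegrE//; lra.
rewrite ger0_norm ?subr_ge0//.
have [d2|d2] := leP 2 d; first by lra.
have Ap : A * p <= 1.
  rewrite /A mulNr expRN mulrC ler_pdivrMr ?expR_gt0// mul1r.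
  by apply: le_trans (expR_ge1Dx _); nra.
have CE : C = A * expR (- (d * (p + d / 2))).
  by rewrite /A /C -expRD; congr expR; rewrite /d; field.
have := expR_ge1Dx (- (d * (p + d / 2))).
rewrite CE; move: (expR _) => e he.
have : A * (1 - d * (p + d / 2)) <= A * e by rewrite ler_pM2l.
have : d * (A * p) <= d * 1 by rewrite ler_wpM2l.
have : A * (d * d) <= 1 * (d * 2) by apply: ler_pM; rewrite ?mulr_ge0 ?(ltW A0)// ler_wpM2l// ltW.
move=> h1 h2 h3; clearbody d A; lra.
Qed.

Lemma gauss_scale_lipschitz s y y' : ab s ->
  `|gauss_scale s y - gauss_scale s y'| <= 2 * (a^-1 * (a^-1 * `|y - y'|)).
Proof.
move=> abs; have s0 := ab_gt0 a_gt0 abs.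
have as_ : a <= s by move: abs; rewrite /= in_itv/= => /andP[].
have sa : s^-1 <= a^-1 by rewrite lef_pV2.
have si : 0 <= s^-1 by rewrite invr_ge0 ltW.
rewrite /gauss_scale -mulrBr normrM ger0_norm// mulrCA; apply: ler_pM => //.
apply: (le_trans (gauss_lipschitz _ _)); rewrite ler_pM2l//.
by rewrite -mulrBl normrM mulrC (ger0_norm si) ler_wpM2r.
Qed.

(** From (m - mu)^2 <= 3 (x - m)^2 + (3/2) (x - mu)^2: when m is far from mu,
    either x is far from m and the kernel is small, or x is far from mu and the
    weight is large. *)
Lemma gauss_scale_far mu m x s : ab s ->
  gauss_scale s (x - m) <=
  a^-1 * expR (- ((m - mu) ^+ 2 / (6 * b ^+ 2))) * weight b mu x.
Proof.
move=> abs; have s0 := ab_gt0 a_gt0 abs.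
move: abs; rewrite /= in_itv/= => /andP[as_ sb].
have b0 : 0 < b by exact: lt_le_trans sb.
rewrite /gauss_scale /weight -mulrA -expRD; apply: ler_pM.
- by rewrite invr_ge0 ltW.
- exact: expR_ge0.
- by rewrite lef_pV2.
rewrite ler_expR expr_div_n mulNr.
have h : (x - m) ^+ 2 / b ^+ 2 <= (x - m) ^+ 2 / s ^+ 2.
  rewrite ler_wpM2l ?sqr_ge0// lef_pV2 ?posrE ?exprn_gt0//.
  by apply: lerXn2r; rewrite ?nnegrE ?(ltW s0) ?(ltW b0).
have -> : (x - mu) ^+ 2 / (4 * b ^+ 2) = (x - mu) ^+ 2 / b ^+ 2 / 4.
  by field; rewrite gt_eqF.
have -> : (m - mu) ^+ 2 / (6 * b ^+ 2) = (m - mu) ^+ 2 / b ^+ 2 / 6.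
  by field; rewrite gt_eqF.
have : (m - mu) ^+ 2 / b ^+ 2 <=
    3 * ((x - m) ^+ 2 / b ^+ 2) + 3 / 2 * ((x - mu) ^+ 2 / b ^+ 2).
  rewrite !mulrA -mulrDl ler_wpM2r// ?invr_ge0 ?sqr_ge0//.
  by have := sqr_ge0 (2 * (x - m) + (x - mu)); nra.
lra.
Qed.

End scales.


(** * A finite code for mixtures *)
Section covering.
Context (R : realType).
Implicit Types x y : R.

Definition quantize (B : nat) x : 'I_B.+1 := inord (Num.truncn x).

Lemma quantize_dist B x y : 0 <= x < B.+1%:R -> 0 <= y < B.+1%:R ->
  quantize B x = quantize B y -> `|x - y| <= 1.
Proof.
move=> /andP[x0 xB] /andP[y0 yB] /(congr1 val).
rewrite /= !inordK ?truncn_lt_nat// => E.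
have /andP[x1 x2] := truncn_itv x0; have /andP[y1 y2] := truncn_itv y0.
rewrite -E in y1 y2; rewrite -natr1 in x2 y2.
by rewrite ler_distl; apply/andP; split; lra.
Qed.

Lemma normal_peak1_ge : 4^-1 <= normal_peak 1 :> R.
Proof.
have p0 : 0 < pi *+ 2 :> R by rewrite -mulr_natr mulr_gt0// pi_gt0.
rewrite /normal_peak expr1n mul1r lef_pV2 ?posrE ?sqrtr_gt0 ?p0//.
have p4 : pi <= 4 :> R by have /andP[_] := pihalf_02 R; lra.
apply: (@le_trans _ _ (Num.sqrt (4 ^+ 2))); last by rewrite sqrtr_sqr ger0_norm.
by apply: ler_wsqrtr; rewrite -mulr_natr; lra.
Qed.

Lemma natr_le_exp (l : nat) : l%:R <= expR l%:R :> R.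
Proof. by apply: le_trans (expR_ge1Dx _); lra. Qed.

Lemma exp_nat_ge (k : nat) : 2 ^+ k <= expR k%:R :> R.
Proof.
rewrite -[k%:R]mulr1 expRM_natl; apply: lerXn2r; rewrite ?nnegrE ?expR_ge0//.
exact: expR1_ge2.
Qed.

Lemma taylor_exponent (t : R) : 1 <= t ->
  - (2 * (504 * t)) + 16 * (56 * t) <= - (14 * t).
Proof. by move=> t1; lra. Qed.

Context (n l : nat) (a b mu : R).
Hypothesis n_gt0 : (0 < n)%N.
Hypothesis a_gt0 : 0 < a.
Hypothesis ab_le : a <= b.
Hypothesis l1 : 1 <= l%:R :> R.
Hypothesis nba : n%:R * b / a <= expR l%:R.
Notation ab := (`[a, b]%classic : set (measurableTypeR R)).
Notation prob := (probability (measurableTypeR R) R).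

Context (B J K : nat).
Hypothesis BE : B = Num.truncn (expR (112 * l%:R) : R).
Hypothesis JE : J = (3 * l)%N.
Hypothesis KE : K%:R = 504 * l%:R :> R.
(** All errors are powers of exp (- l), where exp l bounds n b / a.  After
    multiplication by a, the tolerance is at least exp (- 7 l).  A cutoff Z with
    Z / 4 = 14 l makes the scales outside the Taylor range contribute
    exp (- 14 l), and K = 9 Z terms make the Taylor remainder, which is at most
    16 ^ (- K) exp (16 Z), smaller still.  Moments are rounded to
    eta = exp (- 2 Z), so that exp Z * eta is exp (- Z).  With J = 3 l dyadic
    intervals the scales up to b are covered, since 8 ^ l > exp l >= b / a.  Beyond
    the distance D, a mixture is below the tolerance times the weight.  All the
    quantities to be rounded, measured in their units mesh and eta, are at most
    exp (112 l), hence the number B + 1 of values. *)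
Let Z : R := 56 * l%:R.
Let eta : R := expR (- (112 * l%:R)).
Let mesh : R := a * expR (- (9 * l%:R)).
Let D : R := 7 * b * l%:R.

Definition net_index : finType :=
  option ('I_B.+1 * {ffun 'I_J * 'I_K -> 'I_B.+1}).

(** [None] is the common code of the mixtures with a remote center. *)
Definition net_code (m : R) (G : prob) : net_index :=
  if `|m - mu| <= D then
    Some (quantize B ((m - mu + D) / mesh),
          [ffun ji : 'I_J * 'I_K => quantize B
             (moment (a * 2 ^+ ji.1) (dyadic a b ji.1) G ji.2 / eta)])
  else None.

Let b_gt0 : 0 < b. Proof. exact: lt_le_trans ab_le. Qed.

Lemma card_net_index : ln #|{: net_index}|%:R <= 120 * 1600 * l%:R ^+ 3 :> R.
Proof.
have lge1 := l1.
rewrite card_option card_prod card_ffun card_prod !card_ord.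
pose X : R := expR (113 * l%:R).
have X2 : 2 <= X.
  apply: le_trans (expR_ge1Dx _); lra.
have BX : B.+1%:R <= X.
  rewrite -natr1 /X (_ : 113 * l%:R = 112 * l%:R + l%:R); last by ring.
  rewrite expRD; have /andP[h _] : (B%:R <= expR (112 * l%:R) :> R) && true.
    by rewrite andbT BE truncn_le// expR_ge0.
  have e1 : 1 <= expR (112 * l%:R) :> R by rewrite -expR0 ler_expR mulr_ge0.
  have e2 : 2 <= expR l%:R :> R by apply: le_trans (expR_ge1Dx _); lra.
  by nra.
have le1 : ((B.+1 * B.+1 ^ (J * K)).+1%:R : R) <= X ^+ (J * K).+2.
  rewrite -natr1 natrM natrX -exprS.
  have h : B.+1%:R ^+ (J * K).+1 <= X ^+ (J * K).+1 by apply: lerXn2r; rewrite ?nnegrE//; lra.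
  have h1 : 1 <= X ^+ (J * K).+1 by rewrite exprn_ege1//; lra.
  rewrite [leRHS]exprS; nra.
apply: (@le_trans _ _ (ln (X ^+ (J * K).+2))).
  by rewrite ler_ln// posrE ?exprn_gt0// ?expR_gt0.
rewrite /X -expRM_natl expRK.
have -> : ((J * K).+2%:R : R) = 1512 * l%:R ^+ 2 + 2.
  by rewrite -addn2 natrD natrM KE JE natrM; ring.
by nra.
Qed.

Lemma net_tolerance_ge : a^-1 * expR (- (7 * l%:R)) <= net_tolerance n a b.
Proof.
have lge1 := l1.
have c := normal_peak1_ge.
have n0 : 0 < n%:R :> R by rewrite ltr0n.
have T0 : 0 < n%:R * b / a by rewrite divr_gt0// mulr_gt0.
have -> : net_tolerance n a b = a^-1 * (normal_peak 1 / 8 * ((n%:R * b / a) ^+ 2)^-1).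
  by rewrite /net_tolerance; field; rewrite !gt_eqF.
apply: ler_wpM2l; first by rewrite invr_ge0 ltW.
have TE : (n%:R * b / a) ^+ 2 <= expR (2 * l%:R).
  by rewrite expRM_natl; apply: lerXn2r; rewrite ?nnegrE ?expR_ge0// ltW.
have E5 : 32 <= expR (5 * l%:R) :> R.
  apply: le_trans (_ : expR 5 <= _); last by rewrite ler_expR; lra.
  by apply: le_trans (exp_nat_ge 5); lra.
rewrite (_ : 7 * l%:R = 5 * l%:R + 2 * l%:R); last by ring.
rewrite opprD expRD; apply: ler_pM; rewrite ?expR_ge0//.
  rewrite expRN; apply: le_trans (_ : 32^-1 <= _); last by lra.
  by rewrite lef_pV2 ?posrE ?expR_gt0.
by rewrite expRN lef_pV2 ?posrE ?expR_gt0 ?exprn_gt0.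
Qed.

Lemma mixture_remote_center m (G : prob) x : G (~` ab) = 0 -> D < `|m - mu| ->
  0 <= mixture_pdf m G x <= net_tolerance n a b * weight b mu x.
Proof.
have lge1 := l1.
move=> Gab Dm; have w0 : 0 < weight b mu x by exact: expR_gt0.
rewrite (ltW (mixture_gt0 a_gt0 Gab m x ab_le))/=.
have e0 : 0 <= a^-1 * expR (- (7 * l%:R)) by rewrite mulr_ge0 ?expR_ge0// invr_ge0 ltW.
have s0 := net_tolerance_ge.
apply: (mixture_le a_gt0 Gab); first by rewrite mulr_ge0 ?(ltW w0)//; exact: le_trans s0.
move=> s abs; apply: (le_trans (gauss_scale_far a_gt0 mu m x abs)).
rewrite ler_pM2r//; apply: le_trans s0; apply: ler_wpM2l.
  by rewrite invr_ge0 ltW.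
rewrite ler_expR lerN2.
have h : D ^+ 2 <= (m - mu) ^+ 2.
  rewrite -(real_normK (num_real (m - mu))); apply: lerXn2r; rewrite ?nnegrE//.
    by rewrite /D !mulr_ge0// ltW.
  exact: ltW.
apply: (@le_trans _ _ (D ^+ 2 / (6 * b ^+ 2))); last first.
  by rewrite ler_pM2r// invr_gt0 mulr_gt0// exprn_gt0.
have -> : D ^+ 2 / (6 * b ^+ 2) = 49 / 6 * l%:R ^+ 2.
  by rewrite /D; field; rewrite gt_eqF.
by nra.
Qed.

Lemma mesh_range m : `|m - mu| <= D -> 0 <= (m - mu + D) / mesh < B.+1%:R.
Proof.
have lge1 := l1.
rewrite ler_norml => /andP[h1 h2].
have mesh0 : 0 < mesh by rewrite mulr_gt0 ?expR_gt0.
rewrite divr_ge0 ?(ltW mesh0)//=; last by lra.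
apply: le_lt_trans (_ : expR (112 * l%:R) < _); last by rewrite BE; exact: truncnS_gt.
rewrite ler_pdivrMr//.
apply: (@le_trans _ _ (2 * D)); first by lra.
have n0 : 1 <= n%:R :> R by rewrite ler1n.
have bE : b <= a * expR l%:R.
  rewrite mulrC -ler_pdivrMr//; apply: le_trans nba.
  by rewrite -mulrA ler_peMl// divr_ge0// ltW.
rewrite /mesh [leRHS]mulrCA -expRD.
have -> : 112 * l%:R - 9 * l%:R = l%:R + l%:R + 101 * l%:R :> R by ring.
rewrite !expRD.
have E : 16 <= expR (101 * l%:R) :> R.
  apply: le_trans (_ : expR 4 <= _); last by rewrite ler_expR; lra.
  by apply: le_trans (exp_nat_ge 4); lra.
have h3 : b * l%:R <= a * expR l%:R * expR l%:R.
  by apply: ler_pM; rewrite ?natr_le_exp// ltW.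
have h4 : 0 <= a * expR l%:R * expR l%:R by rewrite !mulr_ge0 ?expR_ge0// ltW.
rewrite /D !mulrA.
apply: (@le_trans _ _ (a * expR l%:R * expR l%:R * 16)); first by lra.
by rewrite ler_wpM2l.
Qed.

(** The moments contribute 15 l exp (- 14 l) and the centers 2 exp (- 9 l), up to
    the factor 1 / a; each of them is at most half of exp (- 7 l). *)
Lemma cell_width_le :
  J%:R * (a^-1 * (expR Z * eta + 2 * ((16 ^+ K)^-1 * expR (16 * Z)) +
     2 * expR (- (Z / 4)))) + 2 * (a^-1 * (a^-1 * mesh)) <= net_tolerance n a b.
Proof.
have lge1 := l1.
set E : R := expR (- (14 * l%:R)).
have EZ : expR (- (Z / 4)) = E by rewrite /E /Z; congr expR; field.
have E1 : expR Z * eta <= E.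
  by rewrite -expRD ler_expR /Z; lra.
have E2 : (16 ^+ K)^-1 * expR (16 * Z) <= E.
  have h16 : expR 2 <= 16 :> R.
    have := expR1_le4 R; have := expR_gt0 (1 : R).
    have -> : expR 2 = expR 1 * expR 1 :> R by rewrite -expRD; congr expR; lra.
    by nra.
  have h : expR (2 * K%:R) <= 16 ^+ K :> R.
    by rewrite expRM_natr; apply: lerXn2r; rewrite ?nnegrE ?expR_ge0.
  apply: (@le_trans _ _ (expR (- (2 * K%:R)) * expR (16 * Z))).
    rewrite expRN; apply: ler_wpM2r; first exact: expR_ge0.
    by rewrite lef_pV2 ?posrE ?expR_gt0 ?exprn_gt0.
  rewrite -expRD ler_expR KE /Z.
  exact: taylor_exponent.
apply: (@le_trans _ _ (a^-1 * (J%:R * (5 * E) + 2 * expR (- (9 * l%:R))))).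
  rewrite /mesh (mulrA a^-1 a) mulVf ?gt_eqF// mul1r [leRHS]mulrDr.
  rewrite [X in _ <= _ + X](mulrCA a^-1) lerD2r.
  rewrite [leRHS](mulrCA a^-1); apply: ler_wpM2l => //.
  rewrite ler_pM2l ?invr_gt0// EZ; move: E1 E2 => /=.
  move: (expR Z * eta) ((16 ^+ K)^-1 * _) => u v; clearbody E => h1 h2.
  by lra.
apply: le_trans net_tolerance_ge; rewrite ler_pM2l ?invr_gt0//.
have -> : E = expR (- (7 * l%:R)) * expR (- (7 * l%:R)).
  by rewrite -expRD; congr expR; ring.
have -> : expR (- (9 * l%:R)) = expR (- (7 * l%:R)) * expR (- (2 * l%:R)) :> R.
  by rewrite -expRD; congr expR; ring.
have e7 : 0 < expR (- (7 * l%:R)) :> R by exact: expR_gt0.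
have h1 : J%:R * (5 * expR (- (7 * l%:R))) <= 2^-1 :> R.
  rewrite JE natrM mulrA expRN ler_pdivrMr ?expR_gt0//.
  rewrite (_ : 7 * l%:R = l%:R + 6 * l%:R); last by ring.
  rewrite expRD; have := natr_le_exp l.
  have E6 : 32 <= expR (6 * l%:R) :> R.
    apply: le_trans (_ : expR 5 <= _); last by rewrite ler_expR; lra.
    by apply: le_trans (exp_nat_ge 5); lra.
  by nra.
have h2 : expR (- (2 * l%:R)) <= 4^-1 :> R.
  rewrite expRN lef_pV2 ?posrE ?expR_gt0//.
  apply: le_trans (_ : expR 2 <= _); last by rewrite ler_expR; lra.
  by apply: le_trans (exp_nat_ge 2); lra.
by nra.
Qed.

(** Two mixtures in the remote cell are both between 0 and the claimed bound.
    Otherwise the mixing law is changed first, at the same center, and then the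
    center is moved by less than the mesh. *)
Lemma net_code_close m m' (G G' : prob) : G (~` ab) = 0 -> G' (~` ab) = 0 ->
  net_code m G = net_code m' G' ->
  forall x, `|mixture_pdf m G x - mixture_pdf m' G' x| <=
    net_tolerance n a b * weight b mu x.
Proof.
move=> Gab Gab'; rewrite /net_code.
case: leP => mD; case: leP => mD' //; last first.
  move=> _ x; have /andP[h1 h2] := mixture_remote_center x Gab mD.
  have /andP[h3 h4] := mixture_remote_center x Gab' mD'.
  by rewrite ler_distl; apply/andP; split; lra.
have lge1 := l1.
move=> [qm /ffunP qG] x.
have w1 : 1 <= weight b mu x.
  by rewrite /weight -expR0 ler_expR divr_ge0 ?sqr_ge0// mulr_ge0 ?sqr_ge0.
have mesh0 : 0 < mesh by rewrite mulr_gt0 ?expR_gt0.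
have eta0 : 0 < eta by exact: expR_gt0.
have mm : `|m - m'| <= mesh.
  have := quantize_dist (mesh_range mD) (mesh_range mD') qm.
  rewrite -mulrBl normrM (@gtr0_norm _ mesh^-1) ?invr_gt0// ler_pdivrMr// mul1r.
  by have -> : m - mu + D - (m' - mu + D) = m - m' by ring.
have mom j i : (j < J)%N -> (i < K)%N ->
    `|moment (a * 2 ^+ j) (dyadic a b j) G i -
      moment (a * 2 ^+ j) (dyadic a b j) G' i| <= eta.
  move=> jJ iK; have := qG (Ordinal jJ, Ordinal iK); rewrite !ffunE/=.
  have rng (H : prob) : 0 <= moment (a * 2 ^+ j) (dyadic a b j) H i / eta < B.+1%:R.
    have /andP[h1 h2] := moment_bounds (dyadic_start_gt0 a_gt0 j)
      (measurable_dyadic a b j) (@dyadic_ratio _ a b j) H i.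
    rewrite divr_ge0 ?(ltW eta0)//=.
    apply: le_lt_trans (_ : expR (112 * l%:R) < _); last by rewrite BE; exact: truncnS_gt.
    by rewrite ler_pdivrMr// /eta -expRD subrr expR0.
  move=> /(quantize_dist (rng G) (rng G')).
  by rewrite -mulrBl normrM (@gtr0_norm _ eta^-1) ?invr_gt0// ler_pdivrMr// mul1r.
have bJ : b < a * 2 ^+ J.
  rewrite mulrC -ltr_pdivrMr//.
  have n0 : 1 <= n%:R :> R by rewrite ler1n.
  apply: (@le_lt_trans _ _ (expR l%:R)).
    by apply: le_trans nba; rewrite -mulrA ler_peMl// divr_ge0// ltW.
  have e4 : expR l%:R <= 4 ^+ l :> R.
    rewrite -[l%:R]mulr1 expRM_natl; apply: lerXn2r; rewrite ?nnegrE ?expR_ge0//.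
    exact: expR1_le4.
  apply: (le_lt_trans e4); rewrite JE exprM ltrXn2r -?lt0n; last lra.
    by rewrite -(ler1n R).
  exact: ler0n.
have near := mixture_dist_moments a_gt0 m x Z Gab Gab' bJ (ltW eta0) mom.
have lip : `|mixture_pdf m G' x - mixture_pdf m' G' x| <= 2 * (a^-1 * (a^-1 * mesh)).
  apply: (mixture_dist_mean a_gt0 Gab').
    by rewrite !mulr_ge0 ?invr_ge0 ?(ltW mesh0) ?(ltW a_gt0).
  move=> s abs; apply: (le_trans (gauss_scale_lipschitz _ _ _ abs)) => //.
  have -> : x - m - (x - m') = m' - m by ring.
  by rewrite ler_pM2l// !ler_pM2l ?invr_gt0// distrC.
have -> : mixture_pdf m G x - mixture_pdf m' G' x =
    (mixture_pdf m G x - mixture_pdf m G' x) +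
    (mixture_pdf m G' x - mixture_pdf m' G' x) by ring.
apply: (le_trans (ler_normD _ _)); apply: (le_trans (lerD near lip)).
apply: (le_trans cell_width_le); rewrite ler_peMr//.
by apply: le_trans net_tolerance_ge; rewrite mulr_ge0 ?expR_ge0// invr_ge0 ltW.
Qed.

End covering.


(** * Envelopes and the deviation bound *)
Section envelopes.
Context (R : realType) (n : nat) (a b mu : R) (sigma : 'I_n -> R).
Hypothesis n_gt0 : (0 < n)%N.
Hypothesis a_gt0 : 0 < a.
Hypothesis sigma_ab : forall i, a <= sigma i <= b.
Notation leb := (@lebesgue_measure R).
Notation prob := (probability (measurableTypeR R) R).
Notation ab := (`[a, b]%classic : set (measurableTypeR R)).
Let p i := normal_pdf mu (sigma i).
Let fbar := average_density p.

Lemma ab_le : a <= b.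
Proof. by have /andP[h1 h2] := sigma_ab (Ordinal n_gt0); exact: le_trans h1 h2. Qed.

Lemma supp_ab_null (G : prob) : supp G `<=` `[a, b] -> G (~` ab) = 0.
Proof. exact/supp_compl_null/itv_closed. Qed.

Lemma supp_empirical_ab : supp (empirical_prob sigma n_gt0) `<=` `[a, b].
Proof.
apply: supp_empirical; first exact: itv_closed.
by move=> i; rewrite /= in_itv/= sigma_ab.
Qed.

Lemma empirical_mixture_fbar : mixture_pdf mu (empirical_prob sigma n_gt0) = fbar.
Proof. by rewrite mixture_empirical_prob mixture_empirical//; exact: (sigma_gt0 a_gt0 sigma_ab). Qed.

Lemma fbar_gt0 x : 0 < fbar x.
Proof.
rewrite -empirical_mixture_fbar; apply: (mixture_gt0 a_gt0 (supp_ab_null supp_empirical_ab)).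
exact: ab_le.
Qed.

Lemma measurable_fbar : measurable_fun setT fbar.
Proof. by apply: measurable_average => i; exact: measurable_normal_pdf. Qed.

Lemma integral_fbar : (\int[leb]_x (fbar x)%:E = 1)%E.
Proof.
rewrite -empirical_mixture_fbar.
exact: (integral_mixture a_gt0 (supp_ab_null supp_empirical_ab)).
Qed.

Lemma mixture_affinity m (G : prob) : G (~` ab) = 0 -> exists alpha : R,
  (\int[leb]_x (Num.sqrt (mixture_pdf m G x * fbar x))%:E = alpha%:E)%E /\
  hellinger2 fbar (mixture_pdf m G) = (2 - 2 * alpha)%:E.
Proof.
move=> Gab; apply: integral_affinity.
- exact: (measurable_mixture a_gt0 Gab).
- exact: measurable_fbar.
- by move=> x; apply/ltW/(mixture_gt0 a_gt0 Gab)/ab_le.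
- by move=> x; exact/ltW/fbar_gt0.
- exact: (integral_mixture a_gt0 Gab).
- exact: integral_fbar.
Qed.

Let eps := net_tolerance n a b.
Let w := weight b mu.

Lemma net_tolerance_ge0 : 0 <= eps.
Proof.
apply: divr_ge0; apply: mulr_ge0 => //; last exact: sqr_ge0.
- exact: normal_peak_ge0.
- exact: ltW.
Qed.

(** Every nonempty cell is represented by one of its members, raised by the
    tolerance times the weight.  It then dominates each member [f] of the cell
    and is itself at most f + 2 * net_tolerance * weight, which
    [affinity_envelope] turns into a loss of 1 / n in affinity. *)
Lemma exists_envelopes (K : Type) (code : R -> prob -> K) :
  (forall m m' (G G' : prob), G (~` ab) = 0 -> G' (~` ab) = 0 -> code m G = code m' G' ->
    forall x, `|mixture_pdf m G x - mixture_pdf m' G' x| <= eps * w x) ->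
  exists (q : K -> R -> R) (c : K -> R),
    [/\ forall k, measurable_fun setT (q k), forall k x, 0 <= q k x,
      forall k, (\int[leb]_x (Num.sqrt (q k x * fbar x))%:E = (c k)%:E)%E &
      forall m (G : prob) alpha, G (~` ab) = 0 ->
        (\int[leb]_x (Num.sqrt (mixture_pdf m G x * fbar x))%:E = alpha%:E)%E ->
        (forall x, mixture_pdf m G x <= q (code m G) x) /\
        c (code m G) <= alpha + n%:R^-1].
Proof.
move=> codeP.
have w0 x : 0 <= w x by exact: expR_ge0.
have ew0 x : 0 <= eps * w x by rewrite mulr_ge0 ?net_tolerance_ge0.
have envelope k : exists qc : (R -> R) * R,
    [/\ measurable_fun setT qc.1, forall x, 0 <= qc.1 x,
      (\int[leb]_x (Num.sqrt (qc.1 x * fbar x))%:E = qc.2%:E)%E &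
      forall m (G : prob) alpha, G (~` ab) = 0 -> code m G = k ->
        (\int[leb]_x (Num.sqrt (mixture_pdf m G x * fbar x))%:E = alpha%:E)%E ->
        (forall x, mixture_pdf m G x <= qc.1 x) /\ qc.2 <= alpha + n%:R^-1].
  have [[[m0 G0] /= [G00 code0]]|none] :=
      pselect (exists mG : R * prob, mG.2 (~` ab) = 0 /\ code mG.1 mG.2 = k); last first.
    exists (cst 0, 0); split => //=.
      by under eq_integral do rewrite mul0r sqrtr0; rewrite integral0.
    by move=> m G alpha G0 codek; case: none; exists (m, G).
  pose q x := mixture_pdf m0 G0 x + eps * w x.
  have f0 m (G : prob) x : G (~` ab) = 0 -> 0 <= mixture_pdf m G x.
    by move=> Gab; apply/ltW/(mixture_gt0 a_gt0 Gab)/ab_le.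
  have mq : measurable_fun setT q.
    apply: measurable_funD; first exact: (measurable_mixture a_gt0 G00).
    by apply: measurable_funM => //; exact: measurable_weight.
  have q0 x : 0 <= q x by rewrite addr_ge0 ?f0.
  have le_c m (G : prob) alpha : G (~` ab) = 0 -> code m G = k ->
      (\int[leb]_x (Num.sqrt (mixture_pdf m G x * fbar x))%:E = alpha%:E)%E ->
      exists c, (\int[leb]_x (Num.sqrt (q x * fbar x))%:E = c%:E)%E /\
        c <= alpha + n%:R^-1.
    move=> Gab codek Ga.
    apply: (affinity_envelope n_gt0 a_gt0 sigma_ab mq
      (measurable_mixture a_gt0 Gab m) q0 (fun x => f0 m G x Gab) _ Ga) => x.
    have := codeP m0 m G0 G G00 Gab; rewrite code0 codek => /(_ erefl x).
    rewrite ler_distl => /andP[_ h]; rewrite /q -/eps -/w.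
    by rewrite -mulrA; move: (eps * w x) h => u h; lra.
  have [alpha0 [alpha0E _]] := mixture_affinity m0 G00.
  have [c [cE _]] := le_c m0 G0 alpha0 G00 code0 alpha0E.
  exists (q, c); split => //= m G alpha Gab codek Ga; split.
    move=> x; have := codeP m0 m G0 G G00 Gab; rewrite code0 codek => /(_ erefl x).
    by rewrite ler_distlC => /andP[_ h]; rewrite /q; lra.
  have [c' [c'E c'le]] := le_c m G alpha Gab codek Ga.
  have E : c%:E = c'%:E by rewrite -cE -c'E.
  by rewrite (EFin_inj E).
have [qc qcP] := choice envelope.
exists (fun k => (qc k).1), (fun k => (qc k).2); split.
- by move=> k; have [] := qcP k.
- by move=> k; have [] := qcP k.
- by move=> k; have [] := qcP k.
- by move=> m G alpha Gab Ga; have [_ _ _] := qcP (code m G); exact.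
Qed.

End envelopes.

Section statistical_bound.
Context (R : realType) (n : nat) (a b mu : R) (sigma : 'I_n -> R).
Context d (T : measurableType d) (P : probability T R) (X : 'I_n -> {RV P >-> R}).
Context (muhat : T -> R) (Ghat : T -> probability (measurableTypeR R) R).
Hypothesis n_gt0 : (0 < n)%N.
Hypothesis a_gt0 : 0 < a.
Hypothesis sigma_ab : forall i, a <= sigma i <= b.
Hypothesis indX : mutually_independent X.
Hypothesis lawX : forall i (A : set (measurableTypeR R)), measurable A ->
  distribution P (X i) A = normal_prob mu (sigma i) A.
Hypothesis mle : forall w, is_mle a b (fun i => X i w) (muhat w) (Ghat w).
Notation prob := (probability (measurableTypeR R) R).
Notation ab := (`[a, b]%classic : set (measurableTypeR R)).

(** The threshold for a cell is the affinity of its envelope plus 1 / n, which is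
    positive and at most the affinity of the fitted mixture plus 2 / n, that is,
    1 - H^2 / 2 + 2 / n. *)
Lemma hellinger_mle_covering (K : finType) (code : R -> prob -> K) (delta : R) :
  (forall m m' (G G' : prob), G (~` ab) = 0 -> G' (~` ab) = 0 -> code m G = code m' G' ->
    forall x, `|mixture_pdf m G x - mixture_pdf m' G' x| <=
      net_tolerance n a b * weight b mu x) ->
  0 < delta ->
  exists E : set T, [/\ measurable E, ((1 - delta)%:E <= P E)%E &
    forall w, E w ->
      (hellinger2 (mixture_pdf mu (empirical sigma)) (mixture_pdf (muhat w) (Ghat w))
       <= (n%:R^-1 * (4 + 2 * ln (#|K|%:R / delta)))%:E)%E].
Proof.
move=> codeP delta0.
have [q [c [mq q0 qc cP]]] := exists_envelopes n_gt0 a_gt0 sigma_ab codeP.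
have fbar0 := fbar_gt0 mu n_gt0 a_gt0 sigma_ab.
have n0 : 0 < n%:R :> R by rewrite ltr0n.
have c0 k : 0 <= c k.
  by rewrite -lee_fin -qc integral_ge0// => x _; rewrite lee_fin sqrtr_ge0.
pose bb k := c k + n%:R^-1.
have bb0 k : 0 < bb k by rewrite ltr_wpDl// invr_gt0.
have cbb k : c k <= bb k by rewrite lerDl invr_ge0 ltW.
have [E [mE PE EP]] := exists_likelihood_event n_gt0 indX
  (fun i => measurable_normal_pdf mu (sigma i))
  (fun i => normal_pdf_ge0 mu (sigma i)) lawX fbar0 mq q0 qc cbb bb0 delta0.
exists E; split => // w Ew.
have [supG mleG] := mle w.
have Gab := supp_ab_null supG.
have [alpha [alphaE hE]] := mixture_affinity mu n_gt0 a_gt0 sigma_ab (muhat w) Gab.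
have [fq cle] := cP _ _ _ Gab alphaE.
set k := code _ _ in fq cle.
have ->: mixture_pdf mu (empirical sigma) =
    average_density (fun i => normal_pdf mu (sigma i)).
  by apply: mixture_empirical => // i; exact: (sigma_gt0 a_gt0 sigma_ab).
rewrite hE lee_fin.
have K0 : 0 < #|K|%:R :> R by rewrite ltr0n; apply/card_gt0P; exists k.
have lik : \sum_(i < n) ln (average_density (fun i => normal_pdf mu (sigma i)) (X i w))
    <= \sum_(i < n) ln (mixture_pdf (muhat w) (Ghat w) (X i w)).
  have := mleG mu (empirical_prob sigma n_gt0)
    (@supp_empirical_ab _ _ _ _ _ n_gt0 sigma_ab).
  by rewrite /mean_loglik ler_pM2l ?invr_gt0// (empirical_mixture_fbar mu n_gt0 a_gt0 sigma_ab).
have bh : bb k <= 1 - (1 - alpha - 2 * n%:R^-1) by rewrite /bb; lra.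
have := likelihood_event_deviation fbar0
  (fun x => mixture_gt0 a_gt0 Gab (muhat w) x (ab_le n_gt0 sigma_ab))
  fq (bb0 k) bh (divr_gt0 K0 delta0) (EP w Ew k) lik.
move=> h.
have : 1 - alpha - 2 * n%:R^-1 <= n%:R^-1 * ln (#|K|%:R / delta).
  by rewrite ler_pdivlMl.
by rewrite mulrDr (mulrCA _ 2); lra.
Qed.

End statistical_bound.


Lemma log_count_bound (R : realType) (lnN L M D : R) (l : nat) :
  lnN <= 120 * 1600 * l%:R ^+ 3 -> l%:R <= 2 * L -> 1 <= L -> 1 <= M -> 0 <= D ->
  4 + 2 * (lnN + D) <= (4 + 16 * (120 * 1600)) * (L ^+ 3 * M ^+ 4 + D).
Proof.
move=> hN hl hL hM hD.
have L3 : 1 <= L ^+ 3 by rewrite exprn_ege1.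
have M4 : 1 <= M ^+ 4 by rewrite exprn_ege1.
have l3 : l%:R ^+ 3 <= 8 * L ^+ 3.
  have -> : 8 * L ^+ 3 = (2 * L) ^+ 3 by ring.
  by apply: lerXn2r; rewrite ?nnegrE//; lra.
have LM : L ^+ 3 <= L ^+ 3 * M ^+ 4 by rewrite ler_peMr//; lra.
move: (L ^+ 3) (L ^+ 3 * M ^+ 4) (l%:R ^+ 3) L3 l3 LM hN => u v t h1 h2 h3 h4.
lra.
Qed.

Theorem theorem1p4 (R : realType) :
  exists C : R, 0 < C /\
  forall (n : nat) (smin smax mu : R) (sigma : 'I_n -> R)
    (d : measure_display) (T : measurableType d) (P : probability T R)
    (X : 'I_n -> {RV P >-> R})
    (muhat : T -> R) (Ghat : T -> probability (measurableTypeR R) R),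
    (1 <= n)%N ->
    0 < smin -> smin <= smax ->
    (forall i, smin <= sigma i <= smax) ->
    mutually_independent X ->
    (forall i (A : set (measurableTypeR R)), measurable A ->
       distribution P (X i) A = normal_prob mu (sigma i) A) ->
    (forall w, is_mle smin smax (fun i => X i w) (muhat w) (Ghat w)) ->
    forall delta : R, 0 < delta < 1 ->
    exists E : set T,
      [/\ measurable E,
          ((1 - delta)%:E <= P E)%E &
          forall w, E w ->
            (hellinger2 (mixture_pdf mu (empirical sigma))
                        (mixture_pdf (muhat w) (Ghat w))
             <= (C / n%:R *
                   (log1 (n%:R * smax / smin) ^+ 3 *
                      loglog1 (n%:R * smax / smin) ^+ 4 +
                    ln (delta^-1)))%:E)%E].
Proof.
(* 4 + 2 ln N, where ln N <= 120 * 1600 * l ^ 3 and l <= 2 * log1 t *)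
exists (4 + 16 * (120 * 1600)); split; first lra.
move=> n a b mu sigma d T P X muhat Ghat n_gt0 a_gt0 ab sigma_ab indX lawX mle.
move=> delta /andP[delta0 delta1].
have n1 : 1 <= n%:R :> R by rewrite ler1n.
set t := n%:R * b / a.
have t1 : 1 <= t by rewrite /t ler_pdivlMr// mul1r; nra.
have t0 : 0 < t by lra.
have lnt0 : 0 <= ln t by rewrite ln_ge0.
pose l := (Num.truncn (ln t)).+1.
have l1 : 1 <= l%:R :> R by rewrite ler1n.
have tl : t <= expR l%:R.
  by rewrite -ler_ln ?posrE ?expR_gt0// expRK; apply: ltW; exact: truncnS_gt.
have l2 : l%:R <= 2 * log1 t.
  have h1 : ln t <= log1 t by rewrite /log1 le_max lexx orbT.
  have h2 : 1 <= log1 t by rewrite /log1 le_max lexx.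
  have h3 : (Num.truncn (ln t))%:R <= ln t by rewrite truncn_le.
  by rewrite /l -natr1; lra.
have [E [mE PE HE]] := hellinger_mle_covering n_gt0 a_gt0 sigma_ab indX lawX mle
  (net_code_close (mu := mu) n_gt0 a_gt0 ab l1 tl (erefl _) (erefl _) (natrM R 504 l))
  delta0.
exists E; split => // w Ew; apply: (le_trans (HE w Ew)); rewrite lee_fin.
rewrite -[C in _ <= C]mulrA [leRHS]mulrCA; apply: ler_wpM2l.
  by rewrite invr_ge0; lra.
set K := net_index _ _ _.
have K0 : 0 < #|K|%:R :> R by rewrite ltr0n; apply/card_gt0P; exists None.
rewrite lnM ?posrE ?invr_gt0//.
apply: (log_count_bound (l := l)) => //.
- exact: (card_net_index l1 (erefl _) (erefl _) (natrM R 504 l)).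
- by rewrite /log1 le_max lexx.
- by rewrite /loglog1 le_max lexx.
- by rewrite ln_ge0// invf_ge1// ltW.
Qed.
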